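(* For $i=1,2$ let $g_i$ and $G_i$ denote the density and the distribution function of the $\chi^2_{m_i}$ distribution. Let $\psi_1:(0,\infty)\to(0,\infty)$ be a function satisfying: (i) $\psi_1(r)$ is non-decreasing and $\lim_{r\to0}\psi_1(r)=\alpha_{2E}:=\dfrac{1}{m_2E(\tau^{-1})}$; (ii) for all $r>0$, $$\psi_1(r)\le\frac{\displaystyle\int_0^\infty\!\int_0^\infty g_2(v_2)\,\bigl(1-G_1(v_2r)\bigr)\,dv_2\,d\Pi(\tau)}{\displaystyle\int_0^\infty\!\int_0^\infty \frac{v_2}{\tau}\,g_2(v_2)\,\bigl(1-G_1(v_2r)\bigr)\,dv_2\,d\Pi(\tau)}.$$ Then, with $Z_1^*=S_1/S_2$ and with respect to the entropy loss $L_2$, the risk of the estimator $\delta_{\psi_1}=\psi_1(Z_1^* )S_2$ of $\sigma_2^2$ is uniformly smaller than that of $\delta_{02}^E=\alpha_{2E}S_2$.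
   Context: Model: $p,q,m_1,m_2$ are positive integers; $\tau$ is a positive random variable (mixing variable) with known distribution $\Pi$ on $(0,\infty)$, and $E(\tau^{-1})$ denotes the (finite) expectation of $\tau^{-1}$. Conditionally on $\tau$, the variables $\boldsymbol X_1,S_1,\boldsymbol X_2,S_2$ are independent with $\boldsymbol X_1\sim N_p(\boldsymbol\theta_1,\frac{\sigma_1^2}{\tau}I)$, $S_1\sim\frac{\sigma_1^2}{\tau}\chi^2_{m_1}$, $\boldsymbol X_2\sim N_q(\boldsymbol\theta_2,\frac{\sigma_2^2}{\tau}I)$, $S_2\sim\frac{\sigma_2^2}{\tau}\chi^2_{m_2}$ (the same $\tau$ for all four); thus $V_i=\tau S_i/\sigma_i^2$ has, given $\tau$, density $g_i$ and distribution function $G_i$. The unknown parameters are $\boldsymbol\theta_1\in\mathbb R^p$, $\boldsymbol\theta_2\in\mathbb R^q$, $\sigma_1,\sigma_2>0$ with the order restriction $\sigma_1\le\sigma_2$. The entropy loss for estimating $\sigma^2$ by $\delta$ is $L_2(\delta,\sigma^2)=\delta/\sigma^2-\ln(\delta/\sigma^2)-1$; the risk of an estimator $\delta$ of $\sigma_2^2$ is $R(\delta)=E[L_2(\delta,\sigma_2^2)]$, a function of the parameters. $\delta_{02}^E$ is the best affine equivariant estimator (BAEE) of $\sigma_2^2$ under $L_2$. The risk of $\delta'$ is uniformly smaller than that of $\delta$ if $R(\delta')<R(\delta)$ for all parameter values satisfying the order restriction.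
   Formalization: Strict inequality for all parameters is false (ψ1 constant equal to α_2E gives equal risks); proved: risk ≤ always, and < when the BAEE risk is finite and ψ1(r)<ψ1(s) for some r<s with either σ1<σ2 or strict inequality in (ii) at r. *)

(* Defs.v *)
From HB Require Import structures.
From mathcomp Require Import all_boot all_order all_algebra.
From mathcomp Require Import all_classical all_reals all_analysis.

Set Implicit Arguments.
Unset Strict Implicit.
Unset Printing Implicit Defensive.

Import Order.TTheory GRing.Theory Num.Theory.
Import numFieldNormedType.Exports.

Local Open Scope classical_set_scope.
Local Open Scope ring_scope.

Section chi_square.
Context {R : realType}.
Implicit Types (a c x : R) (m : nat).

Definition Gamma a : R :=
  \int[lebesgue_measure]_(x in `]0, +oo[) (x `^ (a - 1) * expR (- x)).

Definition chi2_pdf m x : R :=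
  if 0 < x then
    x `^ (m%:R / 2 - 1) * expR (- (x / 2)) / (2 `^ (m%:R / 2) * Gamma (m%:R / 2))
  else 0.

Definition chi2_prob m (A : set R) : \bar R :=
  (\int[lebesgue_measure]_(v in A) (chi2_pdf m v)%:E)%E.

Definition chi2_cdf m x : R := fine (chi2_prob m `]-oo, x]).

(* Law of c * V, where V has the chi-square law with m degrees of freedom. *)
Definition scaled_chi2_prob m c (A : set R) : \bar R :=
  chi2_prob m [set v | A (c * v)].

End chi_square.

(* Mass given to the box B_0 x ... x B_(n-1) by the n-variate normal law with
   mean th and covariance matrix c I (c is the variance, whereas normal_prob
   takes a standard deviation). *)
Definition isotropic_normal_box {R : realType} (n : nat) (th : n.-tuple R) (c : R)
    (B : 'I_n -> set R) : \bar R :=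
  (\prod_(i < n) normal_prob (tnth th i) (Num.sqrt c) (B i))%E.

Definition in_box {R : realType} (n : nat) (B : 'I_n -> set R) :
    set (n.-tuple R) :=
  [set x | forall i, B i (tnth x i)].

(* tau has law Pi and, conditionally on tau = t, the variables X1, S1, X2, S2
   are independent with laws N_p(th1, (sg1^2/t) I), (sg1^2/t) chi2_m1,
   N_q(th2, (sg2^2/t) I), (sg2^2/t) chi2_m2. The conditional statement is
   expressed by the joint law on the measurable rectangles, which form a
   generating pi-system. *)
Definition mixture_model {R : realType} (Pi : probability R R) (p q m1 m2 : nat)
    (th1 : p.-tuple R) (th2 : q.-tuple R) (sg1 sg2 : R)
    (d : measure_display) (T : measurableType d) (P : probability T R)
    (tau : {RV P >-> R}) (X1 : {RV P >-> p.-tuple R}) (S1 : {RV P >-> R})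
    (X2 : {RV P >-> q.-tuple R}) (S2 : {RV P >-> R}) : Prop :=
  (forall A : set R, measurable A -> distribution P tau A = Pi A) /\
  (forall (A C1 C2 : set R) (B1 : 'I_p -> set R) (B2 : 'I_q -> set R),
    measurable A -> measurable C1 -> measurable C2 ->
    (forall i, measurable (B1 i)) -> (forall j, measurable (B2 j)) ->
    P (tau @^-1` A `&` X1 @^-1` in_box B1 `&` S1 @^-1` C1
         `&` X2 @^-1` in_box B2 `&` S2 @^-1` C2) =
    (\int[Pi]_(t in A `&` `]0%R, +oo[)
       (isotropic_normal_box th1 (sg1 ^+ 2 / t)%R B1
        * scaled_chi2_prob m1 (sg1 ^+ 2 / t)%R C1
        * isotropic_normal_box th2 (sg2 ^+ 2 / t)%R B2
        * scaled_chi2_prob m2 (sg2 ^+ 2 / t)%R C2))%E).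

Definition entropy_loss {R : realType} (delta s2 : R) : R :=
  delta / s2 - ln (delta / s2) - 1.

(* Extended-real valued: the entropy loss is nonnegative on positive estimates,
   so the expectation always makes sense but may be +oo. *)
Definition entropy_risk {R : realType} (d : measure_display)
    (T : measurableType d) (P : probability T R) (delta : T -> R) (s2 : R) :
    \bar R :=
  'E_P[fun w => entropy_loss (delta w) s2].

Definition mean_inv {R : realType} (Pi : probability R R) : R :=
  \int[Pi]_(t in `]0, +oo[) t^-1.

Definition alpha2E {R : realType} (Pi : probability R R) (m2 : nat) : R :=
  (m2%:R * mean_inv Pi)^-1.

Definition delta02E {R : realType} (Pi : probability R R) (m2 : nat)
    (T : Type) (S2 : T -> R) : T -> R :=
  fun w => alpha2E Pi m2 * S2 w.

Definition delta_psi {R : realType} (psi : R -> R) (T : Type) (S1 S2 : T -> R) :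
    T -> R :=
  fun w => psi (S1 w / S2 w) * S2 w.

Definition psi_bound {R : realType} (Pi : probability R R) (m1 m2 : nat)
    (r : R) : R :=
  (\int[Pi]_(t in `]0, +oo[) \int[lebesgue_measure]_(v in `]0, +oo[)
     (chi2_pdf m2 v * (1 - chi2_cdf m1 (v * r)))) /
  (\int[Pi]_(t in `]0, +oo[) \int[lebesgue_measure]_(v in `]0, +oo[)
     (v / t * chi2_pdf m2 v * (1 - chi2_cdf m1 (v * r)))).

(* Main.v *)
Require Import Defs.
From HB Require Import structures.
From mathcomp Require Import all_boot all_order all_algebra.
From mathcomp Require Import all_classical all_reals all_analysis.
From mathcomp Require Import measurable_realfun ring lra.

(** Write [Y = S2 / sg2^2], [Z = S1 / S2], [a = alpha2E] and [W = psi1 Z >= a].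
    The loss difference [L(W Y) - L(a Y)] is the integral over [y > a] of
    [Y - 1 / y] on the event [{y < W}]. By Tonelli it therefore suffices that
    [y E[Y; y < W] <= P(y < W)] for every [y > a] (the logarithmic part is made
    finite by truncating [W], and Fatou's lemma removes the truncation).

    As [psi1] is monotone, [{y < W}] is an increasing union of events
    [{Z >= x}] with [psi1 x > y]. With [V1], [V2] the two chi-square variables,
    [P(Z >= x)] and [E[Y; Z >= x]] are the numerator and the denominator of
    [psi_bound (x sg2^2 / sg1^2)], since [tau] cancels in [Z]; hence the
    required inequality follows from
    [y < psi1 x <= psi1 (x sg2^2 / sg1^2) <= psi_bound (x sg2^2 / sg1^2)].

    For strictness one needs a gap on an interval of levels [y]. If [sg1 < sg2],
    some jump of [psi1] over a ratio [sg2^2 / sg1^2] provides it; if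
    [psi1 r < psi_bound r], it comes from the monotonicity of [psi_bound], which
    holds because the conditional mean of [V2] given [V1 / V2 = u] is a constant
    multiple of [1 / (1 + u)]. *)

Set Implicit Arguments.
Unset Strict Implicit.
Unset Printing Implicit Defensive.

Import Order.TTheory GRing.Theory Num.Theory.
Import numFieldNormedType.Exports.

Local Open Scope classical_set_scope.
Local Open Scope ring_scope.

(** * Measure-theoretic preliminaries *)

Section image_measure.
Context d d' (T : measurableType d) (T' : measurableType d') (R : realType).
Variables (mu : {measure set T -> \bar R}) (f : T -> T').
Hypothesis mf : measurable_fun setT f.

Definition image_measure : {measure set T' -> \bar R} :=
  measure_function_pushforward__canonical__measure_function_Measure mu mf.

Lemma image_measureE A : image_measure A = mu (f @^-1` A).
Proof. by []. Qed.

Lemma integral_image_measure (h : T' -> \bar R) : measurable_fun setT h ->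
  (forall y, 0 <= h y)%E ->
  (\int[image_measure]_y h y = \int[mu]_x h (f x))%E.
Proof. by move=> mh h0; rewrite ge0_integral_pushforward. Qed.

End image_measure.

(** * Measures given by a density *)

Section density.
Context d (T : measurableType d) (R : realType).
Variable mu : {measure set T -> \bar R}.
Local Open Scope ereal_scope.

(** The two proofs are arguments so that the measure structure declared below can be attached to the
    term itself. *)
Definition density (f : T -> R) of (forall x, (0 <= f x)%R)
    & measurable_fun setT f := fun A : set T => \int[mu]_(x in A) (f x)%:E.

Variables (f : T -> R) (f0 : forall x, (0 <= f x)%R)
  (mf : measurable_fun setT f).

Let density0 : density f0 mf set0 = 0.
Proof. exact: integral_set0. Qed.

Let density_ge0 A : 0 <= density f0 mf A.
Proof. by apply: integral_ge0 => x _; rewrite lee_fin. Qed.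

Let density_sigma_additive : semi_sigma_additive (density f0 mf).
Proof.
move=> /= F mF tF mUF; rewrite /density; apply: cvg_toP.
  apply: ereal_nondecreasing_is_cvgn => m n mn.
  apply: lee_sum_nneg_natr => // k _ _.
  by apply: integral_ge0 => x _; rewrite lee_fin.
rewrite ge0_integral_bigcup//=; last by move=> x _; rewrite lee_fin.
exact/measurable_EFinP/measurable_funTS.
Qed.

HB.instance Definition _ := isMeasure.Build _ _ _ (density f0 mf)
  density0 density_ge0 density_sigma_additive.

Import HBNNSimple.

(** Monotone convergence along simple functions increasing to [h], applied on both sides, reduces
    the formula to indicators, where it is the definition of [density]. *)
Lemma integral_density (h : T -> \bar R) : (forall x, 0 <= h x) ->
  measurable_fun setT h ->
  \int[density f0 mf]_x h x = \int[mu]_x (h x * (f x)%:E).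
Proof.
move=> h0 mh; pose g := nnsfun_approx measurableT mh.
have mEf : measurable_fun setT (EFin \o f) by exact/measurable_EFinP.
transitivity (limn (fun n => \int[density f0 mf]_x (g n x)%:E)).
  rewrite -monotone_convergence//.
  - apply: eq_integral => x _; apply/esym/cvg_lim => //.
    exact: cvg_nnsfun_approx.
  - by move=> n; exact/measurable_EFinP.
  - by move=> n x _; rewrite lee_fin.
  - by move=> x _ a b ab; rewrite lee_fin; exact/lefP/nd_nnsfun_approx.
transitivity (limn (fun n => \int[mu]_x ((g n x)%:E * (f x)%:E))); last first.
  rewrite -monotone_convergence//.
  - apply: eq_integral => x _; apply/cvg_lim => //.
    by apply: cvgeZr => //; exact: cvg_nnsfun_approx.
  - by move=> n; apply: emeasurable_funM => //; exact/measurable_EFinP.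
  - by move=> n x _; rewrite mule_ge0 ?lee_fin.
  - move=> x _ a b ab; rewrite lee_wpmul2r ?lee_fin//.
    exact/lefP/nd_nnsfun_approx.
congr (limn _); apply/funext => n.
rewrite integralT_nnsfun sintegralE.
transitivity (\int[mu]_x (\sum_(y \in range (g n))
    (y * \1_(g n @^-1` [set y]) x)%:E * (f x)%:E)); last first.
  apply: eq_integral => x _.
  rewrite -ge0_mule_fsuml => [|y]; last exact: nnfun_muleindic_ge0.
  by rewrite fsumEFin // -(fimfunE _ x).
rewrite ge0_integral_fsum//; last 2 first.
  - by move=> y; apply: emeasurable_funM => //; apply/measurable_EFinP;
      exact: measurable_funM.
  - by move=> m y _; rewrite mule_ge0 ?lee_fin// -lee_fin nnfun_muleindic_ge0.
apply: eq_fsbigr => r /[!inE] -[t _ grt].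
under [RHS]eq_integral do rewrite EFinM -muleA.
rewrite ge0_integralZl//.
- congr (_ * _); rewrite /density [LHS]integral_mkcond.
  by apply: eq_integral => x _; rewrite epatch_indic muleC.
- by apply: emeasurable_funM => //; exact/measurable_EFinP.
- by move=> x _; rewrite mule_ge0 ?lee_fin.
- by rewrite -grt lee_fin.
Qed.

End density.

Section integral_conull.
Context d (T : measurableType d) (R : realType).
Variable mu : {measure set T -> \bar R}.
Local Open Scope ereal_scope.
Import HBNNSimple.

(** The integral of a nonnegative function is a supremum over simple functions below it, which makes
    sense without measurability. A simple function below [f], multiplied by the indicator of [D],
    lies below [g] and keeps its integral. *)
Let ge0_le_integral_conull (D : set T) (f g : T -> \bar R) : measurable D ->
  mu (~` D) = 0 -> (forall x, 0 <= f x) -> (forall x, 0 <= g x) ->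
  (forall x, D x -> f x = g x) -> \int[mu]_x f x <= \int[mu]_x g x.
Proof.
move=> mD D0 f0 g0 fg; rewrite !ge0_integralTE//.
apply: ge_ereal_sup => _ [h /= hf <-].
pose k := proj_nnsfun h mD.
have kE x : k x = (h x * \1_D x)%R by [].
rewrite (_ : sintegral mu h = sintegral mu k).
  apply: ereal_sup_ubound; exists k => // x.
  rewrite [(k x)%:E](_ : _ = (h x * \1_D x)%:E) ?indicE//.
  case: (boolP (x \in D)) => [|_]; last by rewrite mulr0.
  by rewrite inE mulr1 => /fg <-.
rewrite -!integralT_nnsfun; apply: ge0_ae_eq_integral => //.
- exact/measurable_EFinP.
- exact/measurable_EFinP.
- by move=> x _; rewrite lee_fin.
- by move=> x _; rewrite lee_fin.
exists (~` D); split => //; first exact: measurableC.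
move=> x /=; apply: contra_not => Dx _; congr EFin.
by rewrite [RHS]kE indicE mem_set// mulr1.
Qed.

(* Unlike [ae_eq_integral], this applies to [delta_psi], which may fail to be
   measurable on the null set where [S1 / S2 <= 0]. *)
Lemma integral_conull (D : set T) (f g : T -> \bar R) : measurable D ->
  mu (~` D) = 0 -> (forall x, D x -> f x = g x) ->
  \int[mu]_x f x = \int[mu]_x g x.
Proof.
move=> mD D0 fg; rewrite integralE [RHS]integralE.
by congr (_ - _); apply/eqP; rewrite eq_le; apply/andP; split;
  apply: (ge0_le_integral_conull mD D0) => // x Dx;
  rewrite ?funeposE ?funenegE fg.
Qed.

End integral_conull.

(** * Scaling of Lebesgue measure *)

Section lebesgue_scaling.
Context {R : realType}.
Notation mu := (@lebesgue_measure R).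
Local Open Scope ereal_scope.

(** Lebesgue measure and [c] times its image under multiplication by [c] agree on half-open
    intervals, hence on all measurable sets by uniqueness. *)
Lemma ge0_integral_scale (c : R) (f : R -> \bar R) : (0 < c)%R ->
  measurable_fun setT f -> (forall x, 0 <= f x) ->
  \int[mu]_x f x = c%:E * \int[mu]_x f (c * x)%R.
Proof.
move=> c0 mf f0.
have mc : measurable_fun [set: R] (fun x : R => c * x : measurableTypeR R)%R.
  exact: measurable_funM.
pose phi (x : R) : measurableTypeR R := (c * x)%R.
pose k : {nonneg R} := NngNum (ltW c0).
pose pm := image_measure mu (mc : measurable_fun setT phi).
have E A : measurable A -> mu A = mscale k pm A.
  apply: lebesgue_measure_unique => _ [[a b] _ <-].
  rewrite -[RHS]/(c%:E * mu (phi @^-1` `]a, b])).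
  have -> : phi @^-1` `]a, b] = `](a / c)%R, (b / c)%R]%classic.
    apply/seteqP; split => x /=; rewrite !in_itv/=;
    by rewrite ltr_pdivrMr// ler_pdivlMr// mulrC.
  rewrite !lebesgue_measure_itv /= !lte_fin ltr_pM2r ?invr_gt0//.
  case: ifPn => _; last by rewrite mule0.
  by rewrite -!EFinB -EFinM; congr EFin; field; rewrite gt_eqF.
transitivity (\int[mscale k pm]_x f x).
  by apply: eq_measure_integral => //= A mA _; exact: E.
rewrite ge0_integral_mscale//=; congr (_ * _).
by rewrite /pm integral_image_measure.
Qed.

End lebesgue_scaling.

(** * Chi-square laws *)

Section gamma_kernel.
Context {R : realType}.
Notation mu := (@lebesgue_measure R).

(** The unnormalised gamma density of shape [k + 1] and rate [b]. *)
Definition gamma_kernel (k b x : R) : R :=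
  if 0 < x then x `^ k * expR (- (b * x)) else 0.

Lemma gamma_kernel_ge0 k b x : 0 <= gamma_kernel k b x.
Proof.
by rewrite /gamma_kernel; case: ifP => // _; rewrite mulr_ge0 ?powR_ge0 ?expR_ge0.
Qed.

Lemma measurable_gamma_kernel k b : measurable_fun setT (gamma_kernel k b).
Proof.
apply: measurable_fun_ifT => //; first exact: measurable_fun_ltr.
apply: measurable_funM; first exact: measurable_powR.
apply: measurableT_comp; first exact: measurable_expR.
by apply: measurableT_comp => //; exact: measurable_funM.
Qed.

Lemma integral_gamma_kernel k b : 0 < b ->
  (\int[mu]_x (gamma_kernel k b x)%:E =
   (b `^ (- (k + 1)))%:E * \int[mu]_x (gamma_kernel k 1 x)%:E)%E.
Proof.
move=> b0; have bV0 : 0 < b^-1 by rewrite invr_gt0.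
rewrite (ge0_integral_scale bV0); last 2 first.
- apply: measurableT_comp => //; exact: measurable_gamma_kernel.
- by move=> x; rewrite lee_fin gamma_kernel_ge0.
rewrite -!ge0_integralZl//; last 6 first.
- apply: measurableT_comp => //; exact: measurable_gamma_kernel.
- by move=> x _; rewrite lee_fin gamma_kernel_ge0.
- by rewrite lee_fin powR_ge0.
- apply: measurableT_comp => //.
  apply: measurableT_comp; last exact: measurable_funM.
  exact: measurable_gamma_kernel.
- by move=> x _; rewrite lee_fin gamma_kernel_ge0.
- by rewrite lee_fin ltW.
apply: eq_integral => x _; rewrite -!EFinM; congr EFin.
rewrite /gamma_kernel pmulr_rgt0//; case: ifPn => x0; last by rewrite !mulr0.
rewrite mulVKf ?gt_eqF// mul1r powRM ?(ltW bV0) ?(ltW x0)// !mulrA.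
congr (_ * _ * _).
rewrite opprD (@powRD _ b); last by rewrite (gt_eqF b0) implybT.
rewrite powR_inv1 ?ltW// mulrC; congr (_ * _).
by rewrite -(@powR_inv1 _ b) ?ltW// -powRrM mulN1r.
Qed.

End gamma_kernel.

Section chi2.
Context {R : realType}.
Notation mu := (@lebesgue_measure R).
Implicit Types (m : nat) (x r : R).

Lemma Gamma_ge0 (a : R) : 0 <= Gamma a.
Proof.
apply: fine_ge0; apply: integral_ge0 => x _.
by rewrite lee_fin mulr_ge0 ?powR_ge0 ?expR_ge0.
Qed.

Definition chi2_cst m : R := (2 `^ (m%:R / 2) * Gamma (m%:R / 2))^-1.

Lemma chi2_cst_ge0 m : 0 <= chi2_cst m.
Proof. by rewrite invr_ge0 mulr_ge0 ?powR_ge0 ?Gamma_ge0. Qed.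

Lemma chi2_pdfE m x :
  chi2_pdf m x = chi2_cst m * gamma_kernel (m%:R / 2 - 1) 2^-1 x.
Proof.
rewrite /chi2_pdf /gamma_kernel; case: ifP => _; last by rewrite mulr0.
by rewrite /chi2_cst mulrC (mulrC x).
Qed.

Lemma chi2_pdf_ge0 m x : 0 <= chi2_pdf m x.
Proof. by rewrite chi2_pdfE mulr_ge0 ?chi2_cst_ge0 ?gamma_kernel_ge0. Qed.

Lemma chi2_pdf_le0 m x : x <= 0 -> chi2_pdf m x = 0.
Proof. by rewrite /chi2_pdf leNgt => /negbTE ->. Qed.

Lemma measurable_chi2_pdf m : measurable_fun setT (@chi2_pdf R m).
Proof.
rewrite (_ : chi2_pdf m = cst (chi2_cst m) \* gamma_kernel (m%:R / 2 - 1) 2^-1).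
  by apply: measurable_funM => //; exact: measurable_gamma_kernel.
by apply/funext => x; rewrite chi2_pdfE.
Qed.

Lemma measurable_Echi2_pdf m :
  measurable_fun setT (fun x : R => (chi2_pdf m x)%:E).
Proof. by apply: measurableT_comp => //; exact: measurable_chi2_pdf. Qed.

(** [Gamma] is the [fine] of an integral, hence 0 if that integral diverges. Its non-vanishing thus
    gives both convergence and an invertible normalising constant. *)
Lemma integral_chi2_pdf m : @Gamma R (m%:R / 2) != 0 ->
  (\int[mu]_x (chi2_pdf m x)%:E = 1)%E.
Proof.
move=> G0; under eq_integral do rewrite chi2_pdfE EFinM.
rewrite ge0_integralZl//; last 3 first.
- apply: measurableT_comp => //; exact: measurable_gamma_kernel.
- by move=> x _; rewrite lee_fin gamma_kernel_ge0.
- by rewrite lee_fin chi2_cst_ge0.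
rewrite integral_gamma_kernel ?invr_gt0//.
have GE : Gamma (m%:R / 2) =
    fine (\int[mu]_x (gamma_kernel (m%:R / 2 - 1) 1 x)%:E)%E.
  rewrite /Gamma /Rintegral integral_mkcond; congr fine.
  apply: eq_integral => x _; rewrite patchE /gamma_kernel mul1r.
  rewrite (_ : (x \in _) = (0 < x)); first by case: ifP.
  by apply/idP/idP; rewrite inE/= in_itv/= andbT.
have -> : (\int[mu]_x (gamma_kernel (m%:R / 2 - 1) 1 x)%:E =
    (Gamma (m%:R / 2))%:E)%E.
  move: G0; rewrite GE.
  by case: (\int[mu]_x _)%E => [r| |] //=; rewrite eqxx.
rewrite subrK -!EFinM; congr EFin; rewrite /chi2_cst.
have -> (a : R) : 2^-1 `^ (- a) = 2 `^ a.
  by rewrite -(@powR_inv1 _ 2)// -powRrM mulN1r opprK.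
by rewrite mulVf// mulf_neq0// gt_eqF// powR_gt0.
Qed.

End chi2.

Section chi2_law.
Context {R : realType}.
Notation mu := (@lebesgue_measure R).

Let measurable_idR : measurable_fun [set: measurableTypeR R] (fun x => x : R).
Proof. by move=> _ A mA; rewrite setTI. Qed.

(** The image under the identity only moves the measure from [measurableTypeR R] to [R], where the
    laws of the model live. *)
Definition chi2_law (m : nat) of @Gamma R (m%:R / 2) != 0 :
    set R -> \bar R :=
  image_measure (density mu (@chi2_pdf_ge0 R m) (@measurable_chi2_pdf R m))
    measurable_idR.

Variables (m : nat) (G0 : @Gamma R (m%:R / 2) != 0).

HB.instance Definition _ := Measure.on (chi2_law G0).

Lemma chi2_lawT : chi2_law G0 setT = 1%E.
Proof. exact: integral_chi2_pdf. Qed.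

HB.instance Definition _ :=
  Measure_isProbability.Build _ _ _ (chi2_law G0) chi2_lawT.

Lemma chi2_lawE (A : set R) : chi2_law G0 A = chi2_prob m A.
Proof. by []. Qed.

Lemma integral_chi2_law (h : R -> \bar R) : (forall x, 0 <= h x)%E ->
  measurable_fun setT h ->
  (\int[chi2_law G0]_x h x = \int[mu]_x (h x * (chi2_pdf m x)%:E))%E.
Proof.
by move=> h0 mh; rewrite integral_image_measure// integral_density.
Qed.

End chi2_law.

Section chi2_tail.
Context {R : realType}.
Notation mu := (@lebesgue_measure R).
Implicit Types (m j : nat) (x r : R).

Definition chi2_surv m x : \bar R := chi2_prob m `[x, +oo[.

(** The law has a density, so the endpoint [x], which belongs to both rays, carries no mass. *)
Lemma chi2_survE m x : @Gamma R (m%:R / 2) != 0 ->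
  chi2_surv m x = (1 - chi2_cdf m x)%:E.
Proof.
move=> G0.
have mg := @measurable_Echi2_pdf R m.
have : (chi2_law G0 `]-oo, x] + chi2_law G0 `]x, +oo[ = 1)%E.
  rewrite -measureU//.
    by rewrite -itv_bndbnd_setU// set_itvNyy; exact: chi2_lawT.
  by rewrite -subset0 => y [] /=; rewrite !in_itv/= andbT leNgt => /negP.
rewrite /chi2_cdf -(chi2_lawE G0) /chi2_surv /chi2_prob.
rewrite -integral_itv_obnd_cbnd; last exact: measurable_funTS.
rewrite -[X in _ -> X = _]/(chi2_law G0 `]x, +oo[).
have: chi2_law G0 `]-oo, x] \is a fin_num by exact: fin_num_measure.
move: (chi2_law G0 `]-oo, x]) => [a| |]//= _.
case: (chi2_law G0 `]x, +oo[) => [b| |] //= [] <-.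
by congr EFin; ring.
Qed.

Lemma measurable_chi2_cdf m : @Gamma R (m%:R / 2) != 0 ->
  measurable_fun setT (@chi2_cdf R m).
Proof.
move=> G0; apply: nondecreasing_measurable => // x y xy.
rewrite /chi2_cdf -!(chi2_lawE G0) fine_le ?fin_num_measure// le_measure//.
- by rewrite inE.
- by rewrite inE.
- by move=> z /=; rewrite !in_itv/= => /le_trans; exact.
Qed.

(* With V1, V2 independent chi-square variables, this is E[V2^j; V1 >= V2 r]. *)
Definition chi2_tail j m1 m2 r : \bar R :=
  (\int[mu]_v ((v ^+ j * chi2_pdf m2 v)%:E * chi2_surv m1 (v * r)))%E.

Lemma chi2_tail_ge0 j m1 m2 r : (0 <= chi2_tail j m1 m2 r)%E.
Proof.
apply: integral_ge0 => v _; rewrite mule_ge0//; last first.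
  by apply: integral_ge0 => u _; rewrite lee_fin chi2_pdf_ge0.
have [v0|v0] := leP v 0; first by rewrite chi2_pdf_le0// mulr0.
by rewrite lee_fin mulr_ge0 ?chi2_pdf_ge0// exprn_ge0// ltW.
Qed.

(** The integrand whose expectation under independent [z.1 = V2] and [z.2 = V1] is [chi2_tail]; the
    guard [0 < z.1] makes it nonnegative everywhere. *)
Definition chi2_ray j r (z : R * R) : \bar R :=
  (if (0 < z.1)%R && (z.1 * r <= z.2)%R then z.1 ^+ j else 0)%:E.

Lemma chi2_ray_ge0 j r z : (0 <= chi2_ray j r z)%E.
Proof.
by rewrite lee_fin; case: ifP => // /andP[z0 _]; rewrite exprn_ge0 ?ltW.
Qed.

Lemma measurable_chi2_ray j r : measurable_fun setT (chi2_ray j r).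
Proof.
apply: measurableT_comp => //; apply: measurable_fun_ifT => //.
- apply: measurable_and; first exact: measurable_fun_ltr.
  by apply: measurable_fun_ler => //; exact: measurable_funM.
- exact: measurable_funX.
Qed.

Lemma chi2_tail_law j m1 m2 r (G1 : @Gamma R (m1%:R / 2) != 0)
    (G2 : @Gamma R (m2%:R / 2) != 0) :
  (\int[chi2_law G2]_v \int[chi2_law G1]_u chi2_ray j r (v, u) =
   chi2_tail j m1 m2 r)%E.
Proof.
rewrite integral_chi2_law; last 2 first.
- by move=> v; apply: integral_ge0 => u _; exact: chi2_ray_ge0.
- exact: (measurable_fun_fubini_tonelli_F (chi2_ray j r) (measurable_chi2_ray j r)
    (chi2_ray_ge0 j r)).
apply: eq_integral => v _; have [v0|v0] := leP v 0.
  by rewrite chi2_pdf_le0// mule0 mulr0 mul0e.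
rewrite EFinM muleAC; congr (_ * _)%E; rewrite /chi2_surv -(chi2_lawE G1).
have -> : chi2_law G1 `[v * r, +oo[ =
    (\int[chi2_law G1]_u (\1_(`[(v * r)%R, +oo[%classic : set R) u)%:E)%E.
  by rewrite integral_indic// setIT.
rewrite -ge0_integralZl//; last 2 first.
- by apply: measurableT_comp => //; exact: measurable_indic.
- by rewrite lee_fin exprn_ge0// ltW.
apply: eq_integral => u _; rewrite /chi2_ray v0/= -EFinM indicE; congr EFin.
rewrite (_ : (u \in _) = (v * r <= u)); first by case: ifP; rewrite (mulr1, mulr0).
by apply/idP/idP; rewrite inE/= in_itv/= andbT.
Qed.

End chi2_tail.

(** * Monotonicity of [psi_bound] *)

Section chi2_tail_ratio.
Context {R : realType}.
Notation mu := (@lebesgue_measure R).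
Variables m1 m2 : nat.

Let k1 : R := m1%:R / 2 - 1.
Let k2 : R := m2%:R / 2 - 1.

Let C : R := chi2_cst m1 * chi2_cst m2.

Let C0 : 0 <= C.
Proof. by rewrite mulr_ge0 ?chi2_cst_ge0. Qed.

(* Up to a factor that depends only on j, the density of E[V2^j; V1 / V2 = u]. *)
Let h j (u : R) : R := C * u `^ k1 * ((1 + u) / 2) `^ (- (k1 + k2 + 2 + j%:R)).

Let h_ge0 j u : 0 <= h j u.
Proof. by rewrite /h mulr_ge0 ?powR_ge0// mulr_ge0 ?powR_ge0. Qed.

Let measurable_h j : measurable_fun setT (h j).
Proof.
apply: measurable_funM.
  by apply: measurable_funM => //; exact: (@measurable_powR R k1).
apply: (@measurableT_comp _ _ _ _ _ _ (fun x : R => x `^ _)).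
  exact: measurable_powR.
apply: measurable_funM => //; by apply: measurable_funD.
Qed.

Let measurable_Eh j :
  measurable_fun setT (fun u : measurableTypeR R => (h j u)%:E).
Proof. by apply: measurableT_comp => //; exact: measurable_h. Qed.

(** The factor omitted from [h]: the gamma integral at [m1 / 2 + m2 / 2 + j]. *)
Let Gj j : \bar R := (\int[mu]_v (gamma_kernel (k1 + k2 + 1 + j%:R) 1 v)%:E)%E.

Let Gj_ge0 j : (0 <= Gj j)%E.
Proof. by apply: integral_ge0 => v _; rewrite lee_fin gamma_kernel_ge0. Qed.

(** The integrand of [chi2_tail] in the coordinates [z = (v, u)] with [V1 = v * u]; the exponent
    [j.+1] includes the Jacobian [v]. *)
Let F j r (z : measurableTypeR R * measurableTypeR R) : \bar R :=
  (if r <= z.2 then z.1 ^+ j.+1 * chi2_pdf m2 z.1 * chi2_pdf m1 (z.1 * z.2)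
   else 0)%:E.

Let F_ge0 j r z : (0 <= F j r z)%E.
Proof.
rewrite lee_fin; case: ifP => // _; have [z0|z0] := leP z.1 0.
  by rewrite chi2_pdf_le0// mulr0 mul0r.
by rewrite !mulr_ge0 ?chi2_pdf_ge0// exprn_ge0// ltW.
Qed.

Let measurable_F j r : measurable_fun setT (F j r).
Proof.
apply: measurableT_comp => //; apply: measurable_fun_ifT => //.
  exact: measurable_fun_ler.
apply: measurable_funM.
  apply: measurable_funM; first exact: measurable_funX.
  by apply: measurableT_comp => //; exact: measurable_chi2_pdf.
apply: measurableT_comp; first exact: measurable_chi2_pdf.
exact: measurable_funM.
Qed.

(** The substitution [V1 = v * u] turns the moving ray into the fixed one [r <= u]. After Tonelli,
    the integrand in [v] is a gamma kernel of rate [(1 + u) / 2], and integrating it out leaves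
    [h j u]. *)
Let chi2_tail_density j r : 0 < r ->
  chi2_tail j m1 m2 r = (Gj j * \int[mu]_(u in `[r, +oo[) (h j u)%:E)%E.
Proof.
move=> r0; transitivity (\int[mu]_v \int[mu]_u F j r (v, u))%E.
  apply: eq_integral => v _; have [v0|v0] := leP v 0.
    rewrite chi2_pdf_le0// mulr0 mul0e integral0_eq// => u _.
    by rewrite /F/= chi2_pdf_le0// mulr0 mul0r; case: ifP.
  pose p (x : R) : R := if v * r <= x then chi2_pdf m1 x else 0.
  have p0 x : 0 <= p x by rewrite /p; case: ifP => // _; exact: chi2_pdf_ge0.
  have mp : measurable_fun setT p.
    apply: measurable_fun_ifT => //; first exact: measurable_fun_ler.
    exact: measurable_chi2_pdf.
  have mpv : measurable_fun setT (fun x : R => p (v * x)).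
    by apply: measurableT_comp => //; exact: measurable_funM.
  have -> : chi2_surv m1 (v * r) = (\int[mu]_x (p x)%:E)%E.
    rewrite /chi2_surv /chi2_prob integral_mkcond; apply: eq_integral => x _.
    rewrite patchE /p (_ : (x \in _) = (v * r <= x)); first by case: ifP.
    by apply/idP/idP; rewrite inE/= in_itv/= andbT.
  rewrite (ge0_integral_scale v0 (f := fun x => (p x)%:E)); last 2 first.
  - exact: measurableT_comp.
  - by move=> x; rewrite lee_fin.
  rewrite muleA -EFinM -ge0_integralZl//; last 3 first.
  - exact: measurableT_comp.
  - by move=> x _; rewrite lee_fin.
  - by rewrite lee_fin !mulr_ge0 ?chi2_pdf_ge0 ?exprn_ge0 ?ltW.
  apply: eq_integral => u _; rewrite -EFinM; congr EFin; rewrite /p ler_pM2l//=.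
  by case: ifP => _; rewrite ?mulr0// exprS; ring.
rewrite (fubini_tonelli (F j r)) //.
rewrite -ge0_integralZl//; last 2 first.
- exact: measurable_funTS.
- by move=> u _; rewrite lee_fin.
rewrite [RHS]integral_mkcond; apply: eq_integral => u _.
rewrite patchE (_ : (_ \in _) = (r <= u)); last first.
  by apply/idP/idP; rewrite inE/= in_itv/= andbT.
case: ifPn => ru; last first.
  by rewrite integral0_eq// => v _; rewrite /F/= (negbTE ru).
have u0 := lt_le_trans r0 ru; have u1 : 0 < (1 + u) / 2 by lra.
transitivity (\int[mu]_v ((C * u `^ k1)%:E *
    (gamma_kernel (k1 + k2 + 1 + j%:R) ((1 + u) / 2) v)%:E))%E.
  apply: eq_integral => v _; rewrite /F/= ru -EFinM; congr EFin.
  rewrite !chi2_pdfE /gamma_kernel pmulr_lgt0//.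
  case: ifPn => v0; last by rewrite !mulr0.
  have pv a b : v `^ (a + b) = v `^ a * v `^ b.
    by rewrite powRD// (gt_eqF v0) implybT.
  have -> : expR (- ((1 + u) / 2 * v)) =
      expR (- (2^-1 * v)) * expR (- (2^-1 * (v * u))).
    by rewrite -expRD; congr expR; field.
  rewrite -/k1 -/k2 powRM ?ltW// !pv powRr1 ?ltW// powR_mulrn ?ltW// exprS /C.
  by ring.
rewrite ge0_integralZl//; last 3 first.
- by apply: measurableT_comp => //; exact: measurable_gamma_kernel.
- by move=> v _; rewrite lee_fin gamma_kernel_ge0.
- by rewrite lee_fin mulr_ge0 ?powR_ge0.
rewrite integral_gamma_kernel// muleA -EFinM muleC; congr (_ * (_ * _)%:E)%E.
by congr (_ `^ - _); ring.
Qed.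

(** The quotient [h 1 u / h 0 u = 2 / (1 + u)] decreases in [u], so its mean over a ray decreases
    with the endpoint. The product form also covers infinite tails. *)
Lemma chi2_tail_ratio (r s : R) : 0 < r -> r <= s ->
  (chi2_tail 1 m1 m2 s * chi2_tail 0 m1 m2 r <=
   chi2_tail 1 m1 m2 r * chi2_tail 0 m1 m2 s)%E.
Proof.
move=> r0 rs; have s0 := lt_le_trans r0 rs.
rewrite !chi2_tail_density//.
pose H j (A : set R) := (\int[mu]_(u in A) (h j u)%:E)%E.
have H_ge0 j A : (0 <= H j A)%E by apply: integral_ge0 => u _; rewrite lee_fin.
have Hsplit j : H j `[r, +oo[%classic =
    (H j `[r, s[%classic + H j `[s, +oo[%classic)%E.
  rewrite /H -ge0_integral_setU//.
  - by rewrite -itv_bndbnd_setU.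
  - exact: measurable_funTS.
  - by move=> u _; rewrite lee_fin.
  - rewrite disj_set2E; apply/eqP; rewrite -subset0 => y [] /=.
    by rewrite !in_itv/= andbT ltNge => /andP[_ /negP].
have hE u : 0 < u -> h 1 u = (2 / (1 + u)) * h 0 u.
  move=> u0; have u1 : 0 < (1 + u) / 2 by lra.
  rewrite /h mulrCA; congr (_ * _); rewrite !addr0 opprD powRD; last first.
    by rewrite (gt_eqF u1) implybT.
  rewrite mulrC; congr (_ * _); rewrite powR_inv1 ?ltW//.
  by field; lra.
(* The quotient [h 1 / h 0] at [s]: a lower bound for it on [[r, s[] and an upper bound on [[s,
   +oo[]. *)
pose c : R := 2 / (1 + s); have c0 : 0 <= c by rewrite divr_ge0//; lra.
have cle : (c%:E * H 0%N `[r, s[%classic <= H 1%N `[r, s[%classic)%E.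
  rewrite /H -ge0_integralZl//; last 2 first.
  - exact: measurable_funTS.
  - by move=> u _; rewrite lee_fin.
  apply: ge0_le_integral => //.
  - by move=> u _; rewrite mule_ge0// lee_fin.
  - by apply: measurable_funTS; exact: emeasurable_funM.
  - exact: measurable_funTS.
  move=> u /=; rewrite in_itv/= => /andP[ru us].
  rewrite -EFinM lee_fin hE; last lra.
  rewrite ler_wpM2r// /c ler_pM2l// lef_pV2 ?posrE; lra.
have cge : (H 1%N `[s, +oo[%classic <= c%:E * H 0%N `[s, +oo[%classic)%E.
  rewrite /H -ge0_integralZl//; last 2 first.
  - exact: measurable_funTS.
  - by move=> u _; rewrite lee_fin.
  apply: ge0_le_integral => //.
  - by move=> u _; rewrite lee_fin.
  - exact: measurable_funTS.
  - by apply: measurable_funTS; exact: emeasurable_funM.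
  move=> u /=; rewrite in_itv/= andbT => us.
  rewrite -EFinM lee_fin hE; last lra.
  rewrite ler_wpM2r// /c ler_pM2l// lef_pV2 ?posrE; lra.
rewrite -!/(H _ _) muleACA [leRHS]muleACA lee_wpmul2l ?mule_ge0//.
rewrite !Hsplit; move: cle cge (H_ge0 0%N `[r, s[%classic).
move: (H_ge0 1%N `[r, s[%classic) (H_ge0 0%N `[s, +oo[%classic).
move: (H_ge0 1%N `[s, +oo[%classic) (H 0%N `[r, s[%classic).
move: (H 1%N `[r, s[%classic) (H 0%N `[s, +oo[%classic).
move: (H 1%N `[s, +oo[%classic).
move=> b1 a1 b0 b1_ge0 a0 a1_ge0 b0_ge0 cle cge a0_ge0.
(* The common term [b1 * b0] drops out, and the cross terms satisfy
   [b1 * a0 <= c * b0 * a0 <= a1 * b0]. *)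
rewrite ge0_muleDr// ge0_muleDl// leeD//.
by rewrite (le_trans (lee_wpmul2r _ cge))// muleAC lee_wpmul2r.
Qed.

End chi2_tail_ratio.

(** * Expression of the bound through chi-square tails *)

Section psi_bound_tail.
Context {R : realType}.
Notation mu := (@lebesgue_measure R).
Variables (m1 m2 : nat) (Pi : probability R R).
Hypothesis Pi_pos : Pi `]0, +oo[%classic = 1%E.
Hypothesis Pi_inv : Pi.-integrable `]0, +oo[ (fun t : R => (t^-1)%:E).
Hypothesis G1 : @Gamma R (m1%:R / 2) != 0.
Implicit Types r s b : R.

Lemma mean_inv_ge0 : 0 <= mean_inv Pi.
Proof.
apply: Rintegral_ge0 => t /=; rewrite in_itv/= andbT => t0.
by rewrite invr_ge0 ltW.
Qed.

Lemma integral_inv :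
  (\int[Pi]_(t in `]0%R, +oo[) (t^-1)%:E = (mean_inv Pi)%:E)%E.
Proof. by rewrite /mean_inv /Rintegral fineK//; exact: integrable_fin_num. Qed.

Let inner j t r : 0 < t ->
  \int[mu]_(v in `]0, +oo[)
     (v ^+ j / t * chi2_pdf m2 v * (1 - chi2_cdf m1 (v * r))) =
  t^-1 * fine (chi2_tail j m1 m2 r).
Proof.
move=> t0; have tV0 : 0 < t^-1 by rewrite invr_gt0.
(* This holds for an infinite tail too: [fine] then makes both sides 0. *)
have -> : t^-1 * fine (chi2_tail j m1 m2 r) =
    fine ((t^-1)%:E * chi2_tail j m1 m2 r)%E.
  by case: (chi2_tail j m1 m2 r) => [x| |]//=;
    rewrite ?(gt0_muley, gt0_muleNy) ?lte_fin//= mulr0.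
congr fine; rewrite /chi2_tail.
under [in RHS]eq_integral do rewrite chi2_survE//.
rewrite -ge0_integralZl//; last 3 first.
- apply: emeasurable_funM; apply: measurableT_comp => //.
    by apply: measurable_funM => //; exact: measurable_chi2_pdf.
  apply: measurable_funB => //; apply: measurableT_comp.
    exact: measurable_chi2_cdf.
  exact: measurable_funM.
- move=> v _; rewrite -EFinM lee_fin.
  have [v0|v0] := leP v 0; first by rewrite chi2_pdf_le0// mulr0 mul0r.
  rewrite mulr_ge0//; first by rewrite mulr_ge0 ?chi2_pdf_ge0 ?exprn_ge0 ?ltW.
  have : (0 <= chi2_surv m1 (v * r))%E.
    by apply: integral_ge0 => u _; rewrite lee_fin chi2_pdf_ge0.
  by rewrite chi2_survE// lee_fin.
- by rewrite lee_fin ltW.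
rewrite integral_mkcond; apply: eq_integral => v _.
rewrite patchE (_ : (_ \in _) = (0 < v)); last first.
  by apply/idP/idP; rewrite inE/= in_itv/= andbT.
case: ifPn => [v0|]; last first.
  by rewrite -leNgt => v0; rewrite chi2_pdf_le0// mulr0 mul0e mule0.
by rewrite -!EFinM; congr EFin; field; rewrite gt_eqF.
Qed.

Lemma psi_boundE r : psi_bound Pi m1 m2 r =
  fine (chi2_tail 0 m1 m2 r) / (mean_inv Pi * fine (chi2_tail 1 m1 m2 r)).
Proof.
rewrite /psi_bound; congr (_ / _).
  (* The numerator does not involve [t]; it is the case [j = 0], [t = 1] of [inner], integrated
     against a law of total mass 1. *)
  have /= := inner 0 r ltr01; rewrite invr1 mul1r => <-.
  rewrite Rintegral_cst//= Pi_pos mulr1; apply: eq_Rintegral => v _.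
  by rewrite expr0 mulr1 mul1r.
have iPi : Pi.-integrable `]0, +oo[ (EFin \o (fun t : R => t^-1)) := Pi_inv.
rewrite /mean_inv -RintegralZr//; apply: eq_Rintegral => t.
rewrite inE/= in_itv/= andbT => t0.
by rewrite -(inner 1 r t0); apply: eq_Rintegral => v _; rewrite expr1.
Qed.

(* [Rintegral] returns 0 on a divergent integral, and x / 0 = 0, so positivity of
   [psi_bound] carries the finiteness of its denominator. *)
Lemma psi_bound_gt0 r : 0 < psi_bound Pi m1 m2 r ->
  [/\ 0 < mean_inv Pi,
   exists2 x, 0 < x & chi2_tail 0 m1 m2 r = x%:E &
   exists2 x, 0 < x & chi2_tail 1 m1 m2 r = x%:E].
Proof.
rewrite psi_boundE; have := mean_inv_ge0.
rewrite le_eqVlt => /predU1P[<-|e0]; first by rewrite mul0r invr0 mulr0 ltxx.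
have := chi2_tail_ge0 0 m1 m2 r; have := chi2_tail_ge0 1 m1 m2 r.
case: (chi2_tail 1 m1 m2 r) => [x| |]//=; last by rewrite mulr0 invr0 mulr0 ltxx.
case: (chi2_tail 0 m1 m2 r) => [y| |]//=; last by rewrite mul0r ltxx.
rewrite !lee_fin => x0 y0 pos; split=> //.
  by exists y => //; rewrite lt_neqAle y0 andbT; apply: contraPneq pos => <-;
    rewrite mul0r ltxx.
by exists x => //; rewrite lt_neqAle x0 andbT; apply: contraPneq pos => <-;
  rewrite mulr0 invr0 mulr0 ltxx.
Qed.

Lemma le_psi_bound b r :
  0 < psi_bound Pi m1 m2 r -> b <= psi_bound Pi m1 m2 r ->
  (b%:E * ((mean_inv Pi)%:E * chi2_tail 1 m1 m2 r) <= chi2_tail 0 m1 m2 r)%E.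
Proof.
move=> pos; have [e0 [x x0 xE] [y y0 yE]] := psi_bound_gt0 pos.
by rewrite psi_boundE xE yE/= ler_pdivlMr ?mulr_gt0// -!EFinM lee_fin.
Qed.

(** Positivity makes all four tails finite and positive, and cross-multiplication then gives
    [chi2_tail_ratio]. *)
Lemma psi_bound_nondecreasing r s : 0 < r -> r <= s ->
  0 < psi_bound Pi m1 m2 r -> 0 < psi_bound Pi m1 m2 s ->
  psi_bound Pi m1 m2 r <= psi_bound Pi m1 m2 s.
Proof.
move=> r0 rs posr poss; have := chi2_tail_ratio m1 m2 r0 rs.
have [e0 [x x0 xE] [y y0 yE]] := psi_bound_gt0 posr.
have [_ [x' x'0 x'E] [y' y'0 y'E]] := psi_bound_gt0 poss.
rewrite !psi_boundE xE yE x'E y'E/= -!EFinM lee_fin => H.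
rewrite ler_pdivrMr ?mulr_gt0// mulrAC ler_pdivlMr ?mulr_gt0//.
by rewrite mulrCA [leRHS]mulrCA ler_pM2l// mulrC [leRHS]mulrC.
Qed.

End psi_bound_tail.

(** * Integration of the loss over levels *)

Lemma integral_powRN1_itv {R : realType} (a b : R) : 0 < a -> a <= b ->
  (\int[@lebesgue_measure R]_(y in `]a, b[) (y `^ (-1))%:E =
   (ln b - ln a)%:E)%E.
Proof.
move=> a0; rewrite le_eqVlt => /predU1P[<-|ab].
  by rewrite set_itv_ge ?bnd_simp ?ltxx// integral_set0 subrr.
rewrite -(@integral_itv_bndoo _ _ _ _ true false); last first.
  by apply: measurable_funTS; apply/measurable_EFinP; exact: measurable_powR.
transitivity (\int[@lebesgue_measure R]_(y in `[a, b]) (y^-1)%:E)%E.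
  apply: eq_integral => y; rewrite inE/= in_itv/= => /andP[ay _].
  by rewrite powR_inv1// (le_trans (ltW a0)).
rewrite EFinB; apply: continuous_FTC2 => //.
- apply: continuous_in_subspaceT => x; rewrite inE/= in_itv/= => /andP[ax _].
  by apply: inv_continuous; rewrite gt_eqF// (lt_le_trans a0).
- split.
  + move=> x; rewrite in_itv/= => /andP[ax _].
    by have [] := is_derive1_ln (lt_trans a0 ax).
  + by apply: cvg_at_right_filter; exact: continuous_ln.
  + by apply: cvg_at_left_filter; apply: continuous_ln; exact: lt_trans ab.
- move=> x; rewrite in_itv/= => /andP[ax _]; rewrite derive1E.
  by have [_ ->] := is_derive1_ln (lt_trans a0 ax).
Qed.

Lemma limn_einf_le_ub {R : realType} (u : (\bar R)^nat) (C : \bar R) :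
  (forall n, u n <= C)%E -> (limn_einf u <= C)%E.
Proof.
move=> uC; rewrite limn_einf_lim; apply: lime_le; first exact: is_cvg_einfs.
apply: nearW => n; apply: le_trans (uC n); apply: ereal_inf_lbound.
by exists n => /=.
Qed.

(** * Layer-cake form of the loss difference *)

Section truncated_loss.
Context d (T : measurableType d) (R : realType) (P : probability T R).
Notation mu := (@lebesgue_measure R).
Variables (a : R) (W Y : T -> R).
Hypotheses (a0 : 0 < a) (aW : forall w, a <= W w) (Y0 : forall w, 0 < Y w).
Hypotheses (mW : measurable_fun setT W) (mY : measurable_fun setT Y).

Let loss (x : R) (w : T) : R := x * Y w - ln (x * Y w) - 1.

Let loss_ge0 x w : 0 < x -> 0 <= loss x w.
Proof.
move=> x0; have xY : 0 < x * Y w by rewrite mulr_gt0.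
have /le_ln1Dx : -1 < x * Y w - 1 by lra.
by rewrite addrC subrK /loss; lra.
Qed.

(** The minimum of [W] and [K]; it keeps the logarithmic part bounded. *)
Let trunc (K : R) (w : T) : R := if W w < K then W w else K.

Let trunc_ge K w : a <= K -> a <= trunc K w.
Proof. by rewrite /trunc; case: ifP. Qed.

Let trunc_gt0 K w : a <= K -> 0 < trunc K w.
Proof. by move=> /(trunc_ge w); exact: lt_le_trans. Qed.

Let measurable_trunc K : measurable_fun setT (trunc K).
Proof. by apply: measurable_fun_ifT => //; exact: measurable_fun_ltr. Qed.

Let measurable_loss (f : T -> R) : measurable_fun setT f ->
  measurable_fun setT (fun w => (loss (f w) w)%:E).
Proof.
move=> mf; apply: measurableT_comp => //; apply: measurable_funB => //.
apply: measurable_funB; first exact: measurable_funM.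
apply: measurableT_comp; first exact: measurable_ln.
exact: measurable_funM.
Qed.

(** [slice K y (W w)] says that [y] lies in []a, trunc K w[]. *)
Let slice (K y : R) : R -> bool := fun x => [&& a < y, y < K & y < x].

Let integral_slice K (w : T) (f : R -> R) : a <= K ->
  (\int[mu]_y (if slice K y (W w) then f y else 0)%:E =
   \int[mu]_(y in `]a, trunc K w[) (f y)%:E)%E.
Proof.
move=> aK; rewrite [RHS]integral_mkcond; apply: eq_integral => y _.
rewrite patchE (_ : (_ \in _) = slice K y (W w)); first by case: ifP.
rewrite /slice /trunc; apply/idP/idP; rewrite inE/= in_itv/=.
  by case: (boolP (a < y)) => //= _; case: (ltP (W w) K) => WK yW; lra.
by case: (boolP (a < y)) => //= _; case: (ltP (W w) K) => WK /andP[]; lra.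
Qed.

(** [FY] and [Fln] integrate over levels to the linear part [(trunc K w - a) * Y w] and the
    logarithmic part [ln (trunc K w) - ln a]; integrated over [w] at a fixed level, they give the
    two sides compared in [gap]. *)
Let FY K (z : measurableTypeR R * T) : \bar R :=
  (if slice K z.1 (W z.2) then Y z.2 else 0)%:E.

Let Fln K (z : measurableTypeR R * T) : \bar R :=
  (if slice K z.1 (W z.2) then z.1 `^ (-1) else 0)%:E.

Let measurable_slice K :
  measurable_fun setT (fun z : measurableTypeR R * T => slice K z.1 (W z.2)).
Proof.
apply: measurable_and; first exact: measurable_fun_ltr.
apply: measurable_and; first exact: measurable_fun_ltr.
by apply: measurable_fun_ltr => //; exact: measurableT_comp.
Qed.

Let measurable_FY K : measurable_fun setT (FY K).
Proof.
apply: measurableT_comp => //; apply: measurable_fun_ifT => //.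
exact: measurableT_comp.
Qed.

Let measurable_Fln K : measurable_fun setT (Fln K).
Proof.
apply: measurableT_comp => //; apply: measurable_fun_ifT => //.
apply: (@measurableT_comp _ _ _ _ _ _ (fun y : R => y `^ (-1))) => //.
Qed.

Let FY_ge0 K z : (0 <= FY K z)%E.
Proof. by rewrite lee_fin; case: ifP => // _; exact: ltW. Qed.

Let Fln_ge0 K z : (0 <= Fln K z)%E.
Proof. by rewrite lee_fin; case: ifP => // _; exact: powR_ge0. Qed.

Let integral_FY K : a <= K ->
  (\int[P]_w ((trunc K w - a) * Y w)%:E = \int[mu]_y \int[P]_w FY K (y, w))%E.
Proof.
move=> aK; rewrite (fubini_tonelli (FY K))//; apply: eq_integral => w _.
rewrite (integral_slice w (fun=> Y w))//= integral_cst//=.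
rewrite lebesgue_measure_itv/= lte_fin; have := trunc_ge w aK.
rewrite le_eqVlt => /predU1P[<-|->].
  by rewrite ltxx subrr mul0r mule0.
by rewrite -EFinB -EFinM mulrC.
Qed.

Let integral_Fln K : a <= K ->
  (\int[P]_w (ln (trunc K w) - ln a)%:E = \int[mu]_y \int[P]_w Fln K (y, w))%E.
Proof.
move=> aK; rewrite (fubini_tonelli (Fln K))//; apply: eq_integral => w _.
rewrite (integral_slice w (fun y => y `^ (-1)))// integral_powRN1_itv//.
exact: trunc_ge.
Qed.

(** [eps] is an excess in the level inequality on []b, c[]; it becomes a gain [eps * (c - b)] in
    risk. *)
Variables (eps b c : R).
Hypotheses (eps0 : 0 <= eps) (ab : a <= b) (bc : b <= c).
Hypothesis gap : forall y, a < y ->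
  (\int[P]_(w in [set w | (y < W w)%R]) (Y w)%:E
     + (if (b < y < c)%R then eps else 0)%:E
   <= (y^-1)%:E * P [set w | (y < W w)%R])%E.

Let gap_trunc K : c <= K ->
  (\int[P]_w ((trunc K w - a) * Y w)%:E + (eps * (c - b))%:E
   <= \int[P]_w (ln (trunc K w) - ln a)%:E)%E.
Proof.
move=> cK; have aK : a <= K := le_trans ab (le_trans bc cK).
rewrite integral_FY// integral_Fln//.
have -> : (eps * (c - b))%:E =
    (\int[mu]_y (if (b < y < c)%R then eps else 0)%:E)%E.
  transitivity (\int[mu]_(y in `]b, c[) (cst eps%:E) y)%E.
    rewrite integral_cst//= lebesgue_measure_itv/= lte_fin -EFinB.
    move: bc; rewrite le_eqVlt => /predU1P[->|->].
      by rewrite ltxx subrr mulr0 mule0.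
    by rewrite EFinM.
  rewrite integral_mkcond; apply: eq_integral => y _; rewrite patchE.
  rewrite (_ : (_ \in _) = (b < y < c)%R); first by case: ifP.
  by apply/idP/idP; rewrite inE/= in_itv.
have mfF : measurable_fun setT (fun y : measurableTypeR R => \int[P]_w FY K (y, w))%E.
  exact: (measurable_fun_fubini_tonelli_F (FY K)).
have mfL : measurable_fun setT (fun y : measurableTypeR R => \int[P]_w Fln K (y, w))%E.
  exact: (measurable_fun_fubini_tonelli_F (Fln K)).
have me : measurable_fun setT
    (fun y : measurableTypeR R => (if (b < y < c)%R then eps else 0)%:E).
  apply: measurableT_comp => //; apply: measurable_fun_ifT => //.
  by apply: measurable_and; exact: measurable_fun_ltr.
have e0 y : (0 <= (if (b < y < c)%R then eps else 0)%:E :> \bar R)%E.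
  by rewrite lee_fin; case: ifP.
rewrite -ge0_integralD//; last by move=> y _; exact: integral_ge0.
apply: ge0_le_integral => //.
- by move=> y _; rewrite adde_ge0//; exact: integral_ge0.
- exact: emeasurable_funD.
move=> y _; case: (boolP ((a < y) && (y < K))) => [/andP[ay yK]|nyK].
  have mA : measurable [set w | (y < W w)%R].
    have := @measurable_fun_ltr _ _ _ setT (cst y) W (measurable_cst _) mW.
    move=> /(_ measurableT [set true] I); rewrite setTI.
    by congr measurable; apply/seteqP; split=> w.
  have -> : (\int[P]_w FY K (y, w) = \int[P]_(w in [set w | (y < W w)%R]) (Y w)%:E)%E.
    rewrite [RHS]integral_mkcond; apply: eq_integral => w _.
    rewrite patchE /FY /slice/= ay yK/= (_ : (_ \in _) = (y < W w)%R).
      by case: ifP.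
    by apply/idP/idP; rewrite inE.
  apply: (le_trans (gap ay)).
  rewrite -(setIT [set w | _]) -integral_indic//.
  rewrite -ge0_integralZl//; last first.
  - by rewrite lee_fin invr_ge0 (le_trans (ltW a0))// ltW.
  - by apply: measurableT_comp => //; exact: measurable_indic.
  rewrite le_eqVlt; apply/orP; left; apply/eqP; apply: eq_integral => w _.
  rewrite /Fln /slice/= ay yK/= indicE (_ : (_ \in _) = (y < W w)%R).
    rewrite powR_inv1; last by rewrite (le_trans (ltW a0))// ltW.
    by case: ifP; rewrite ?mule1 ?mule0.
  by apply/idP/idP; rewrite inE.
(* Outside []a, K[] the slices are empty, and the excess vanishes as well because [a <= b] and
   [c <= K]. *)
have -> : (b < y < c)%R = false.
  apply/negP => /andP[? ?]; move: nyK; apply/negP/negPn/andP; split.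
    exact: le_lt_trans ab _.
    exact: lt_le_trans cK.
rewrite adde0 [leLHS]integral0_eq ?integral_ge0// => w _.
by rewrite /FY /slice/= andbA (negbTE nyK).
Qed.

(** The two losses differ by the linear part minus the logarithmic part, written as a sum [E] since
    the risks may be infinite. Truncation makes [A] finite, so that it can be cancelled. *)
Let risk_trunc K : c <= K ->
  (\int[P]_w (loss (trunc K w) w)%:E + (eps * (c - b))%:E
   <= \int[P]_w (loss a w)%:E)%E.
Proof.
move=> cK; have aK : a <= K := le_trans ab (le_trans bc cK).
set A := (\int[P]_w (ln (trunc K w) - ln a)%:E)%E.
set B := (\int[P]_w ((trunc K w - a) * Y w)%:E)%E.
have lnt w : 0 <= ln (trunc K w) - ln a <= ln K - ln a.
  have t0 := trunc_gt0 w aK; have ta := trunc_ge w aK.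
  rewrite subr_ge0 lerD2r !ler_ln ?posrE//; last exact: lt_le_trans aK.
  by rewrite ta/= /trunc; case: ltP => // /ltW.
have mln : measurable_fun setT (fun w => (ln (trunc K w) - ln a)%:E).
  apply: measurableT_comp => //; apply: measurable_funB => //.
  by apply: measurableT_comp => //; exact: measurable_ln.
have Afin : A \is a fin_num.
  rewrite ge0_fin_numE; last first.
    by apply: integral_ge0 => w _; rewrite lee_fin; case/andP: (lnt w).
  apply: (@le_lt_trans _ _ (\int[P]_w (cst (ln K - ln a)%:E) w)%E); last first.
    by rewrite integral_cst//= probability_setT mule1 ltry.
  apply: ge0_le_integral => //.
  - by move=> w _; rewrite lee_fin; case/andP: (lnt w).
  - by move=> w _; rewrite lee_fin; case/andP: (lnt w).
have BA : (B + (eps * (c - b))%:E <= A)%E by exact: gap_trunc.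
have E : (\int[P]_w (loss (trunc K w) w)%:E + A = \int[P]_w (loss a w)%:E + B)%E.
  rewrite -!ge0_integralD//.
  - apply: eq_integral => w _; rewrite -!EFinD; congr EFin; rewrite /loss.
    rewrite !lnM ?posrE ?trunc_gt0//; ring.
  - by move=> w _; rewrite lee_fin loss_ge0.
  - exact: measurable_loss.
  - by move=> w _; rewrite lee_fin mulr_ge0 ?subr_ge0 ?trunc_ge// ltW.
  - apply: measurableT_comp => //; apply: measurable_funM => //.
    exact: measurable_funB.
  - by move=> w _; rewrite lee_fin loss_ge0// trunc_gt0.
  - exact: measurable_loss.
  - by move=> w _; rewrite lee_fin; case/andP: (lnt w).
rewrite -(@leeD2rE _ A)// addeAC E -addeA.
by rewrite leeD2l.
Qed.

(** For each [w] the truncation at [K n] is inactive for large [n], so Fatou's lemma passes the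
    uniform bound [risk_trunc] to the limit. *)
Lemma risk_improvement :
  (\int[P]_w (loss (W w) w)%:E + (eps * (c - b))%:E
   <= \int[P]_w (loss a w)%:E)%E.
Proof.
rewrite -leeBrDr//.
pose K n : R := c + n%:R.
have cK n : c <= K n by rewrite lerDl.
have aK n : a <= K n by rewrite (le_trans ab)// (le_trans bc).
have Wlim w : (loss (W w) w)%:E = limn_einf (fun n => (loss (trunc (K n) w) w)%:E).
  apply/esym; apply: (cvg_limn_einf_sup _).1; apply: cvg_near_cst.
  near=> n; congr (loss _ _)%:E; rewrite /trunc ifT//.
  by rewrite -ltrBlDl; near: n; exact: nbhs_infty_gtr.
rewrite (eq_integral (fun w => limn_einf (fun n => (loss (trunc (K n) w) w)%:E)));
  last by move=> w _; exact: Wlim.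
apply: (le_trans (fatou _ _ _ _)) => //.
- by move=> n; exact: measurable_loss.
- by move=> n w _; rewrite lee_fin loss_ge0// trunc_gt0.
by apply: limn_einf_le_ub => n; rewrite leeBrDr//; exact: risk_trunc.
Unshelve. all: end_near. Qed.

End truncated_loss.

(** * The law of the ratio of the two sums of squares *)

Section upward_closed.
Context d (T : measurableType d) (R : realType) (P : {measure set T -> \bar R}).
Variables (Z Y : T -> R).
Hypotheses (mZ : measurable_fun setT Z) (mY : measurable_fun setT Y).
Hypothesis Y0 : forall w, 0 <= Y w.

Let preimageZ (x : R) : measurable (Z @^-1` `[x, +oo[).
Proof. by rewrite -[X in measurable X]setTI; exact: mZ. Qed.

(* An upward closed set is the increasing union of closed rays it contains. *)
Lemma upward_closed_le (A : set R) (b l : R) : 0 <= b ->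
  (forall x, A x -> l <= x) -> (forall x y, A x -> x <= y -> A y) ->
  (forall x, A x -> (b%:E * \int[P]_(w in Z @^-1` `[x, +oo[) (Y w)%:E
     <= P (Z @^-1` `[x, +oo[))%E) ->
  (b%:E * \int[P]_(w in Z @^-1` A) (Y w)%:E <= P (Z @^-1` A))%E.
Proof.
move=> b0 lA upA rayA; have [->|/set0P[x0 Ax0]] := eqVneq A set0.
  by rewrite preimage_set0 integral_set0 mule0 measure0.
have [x [Ax xdec AE]] : exists x : R^nat, [/\ forall n, A (x n),
    nonincreasing_seq x & A = \bigcup_n `[x n, +oo[%classic].
  have infA : has_inf A by split; [exists x0|exists l].
  (* If the infimum is attained, [A] is itself a closed ray; otherwise the endpoints
     [inf A + 1 / (n + 1)] decrease to it inside [A]. *)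
  have [AI|nAI] := pselect (A (inf A)).
    exists (fun=> inf A); split => //; apply/seteqP; split => [y Ay|y [_ _]/=].
      by exists 0%N => //=; rewrite in_itv/= andbT; exact: ge_inf infA.2 _ _.
    by rewrite in_itv/= andbT; exact: upA.
  exists (fun n => inf A + n.+1%:R^-1); split.
  - move=> n; have [|y Ay /ltW] := @inf_adherent _ A n.+1%:R^-1 _ infA.
      by rewrite invr_gt0.
    exact: upA.
  - move=> m n mn; rewrite lerD2l lef_pV2 ?posrE// ler_nat.
    by [].
  - apply/seteqP; split => [y Ay|y [n _]/=]; last first.
      rewrite in_itv/= andbT; apply: (upA).
      have [|z Az /ltW] := @inf_adherent _ A n.+1%:R^-1 _ infA.
        by rewrite invr_gt0.
      exact: upA.
    have yI : 0 < y - inf A.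
      rewrite subr_gt0 lt_neqAle ge_inf//; last exact: infA.2.
      by rewrite andbT; apply: contra_notN nAI => /eqP ->.
    exists (Num.truncn (y - inf A)^-1) => //=.
    rewrite in_itv/= andbT -lerBrDl -[leRHS]invrK lef_pV2 ?posrE ?invr_gt0//.
    exact/ltW/truncnS_gt.
rewrite AE preimage_bigcup.
pose F n := Z @^-1` `[x n, +oo[%classic.
have mF n : measurable (F n) by exact: preimageZ.
have ndF : nondecreasing_seq F.
  move=> m n mn; apply/subsetPset => w; rewrite /F/= !in_itv/= !andbT.
  by apply: le_trans; exact: xdec.
have cF : (b%:E * \int[P]_(w in F n) (Y w)%:E @[n --> \oo] -->
    b%:E * \int[P]_(w in \bigcup_n F n) (Y w)%:E)%E.
  apply: cvgeZl => //; apply: ge0_nondecreasing_set_cvg_integral => //.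
  - by move=> n; apply: measurable_funTS; apply/measurable_EFinP.
  - by move=> n w _; rewrite lee_fin.
rewrite -(cvg_lim _ cF)//; apply: lime_le; first by apply/cvg_ex; eexists; exact: cF.
apply: nearW => n; apply: (le_trans (rayA _ (Ax n))).
apply: le_measure; rewrite ?inE//; first exact: bigcup_measurable.
by move=> w Fw; exists n.
Qed.

End upward_closed.

Section mixture_law.
Context {R : realType} (Pi : probability R R) (p q m1 m2 : nat).
Context (th1 : p.-tuple R) (th2 : q.-tuple R) (sg1 sg2 : R).
Context d (T : measurableType d) (P : probability T R).
Context (tau : {RV P >-> R}) (X1 : {RV P >-> p.-tuple R}) (S1 : {RV P >-> R})
    (X2 : {RV P >-> q.-tuple R}) (S2 : {RV P >-> R}).
Hypothesis Pi_pos : Pi `]0, +oo[%classic = 1%E.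
Hypotheses (sg1_pos : 0 < sg1) (sg2_pos : 0 < sg2).
Hypothesis model : mixture_model Pi m1 m2 th1 th2 sg1 sg2 tau X1 S1 X2 S2.

Let normal_boxT n (th : n.-tuple R) (s : R) : 0 < s ->
  isotropic_normal_box th s (fun=> setT) = 1%E.
Proof.
move=> s0; rewrite /isotropic_normal_box big1// => i _.
by rewrite /normal_prob integral_normal_pdf// gt_eqF// sqrtr_gt0.
Qed.

Lemma mixture_model_rect (C1 C2 : set R) : measurable C1 -> measurable C2 ->
  (P (S1 @^-1` C1 `&` S2 @^-1` C2) =
   \int[Pi]_(t in `]0%R, +oo[) (scaled_chi2_prob m1 (sg1 ^+ 2 / t)%R C1
     * scaled_chi2_prob m2 (sg2 ^+ 2 / t)%R C2))%E.
Proof.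
move=> mC1 mC2; have [_ /(_ setT C1 C2 (fun=> setT) (fun=> setT))] := model.
move=> /(_ measurableT mC1 mC2 (fun=> measurableT) (fun=> measurableT)).
rewrite setTI.
rewrite (_ : tau @^-1` _ `&` _ `&` _ `&` _ `&` _ = S1 @^-1` C1 `&` S2 @^-1` C2).
  move=> ->; apply: eq_integral => t; rewrite inE/= in_itv/= andbT => t0.
  by rewrite !normal_boxT ?divr_gt0 ?exprn_gt0// mul1e mule1.
apply/seteqP; split => w /=; first by move=> [[[[]]]].
by move=> [? ?]; split => //; split => //; split.
Qed.

Let chi2_prob_Gamma0 m (A : set R) : @Gamma R (m%:R / 2) = 0 ->
  chi2_prob m A = 0%E.
Proof.
move=> G0; apply: integral0_eq => x _.
by rewrite chi2_pdfE /chi2_cst G0 mulr0 invr0 mul0r.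
Qed.

(** If [Gamma] were 0, division by zero would make the density vanish, and the model would give the
    whole space mass 0 instead of 1. *)
Lemma mixture_model_Gamma_neq0 :
  @Gamma R (m1%:R / 2) != 0 /\ @Gamma R (m2%:R / 2) != 0.
Proof.
have := mixture_model_rect measurableT measurableT.
rewrite !preimage_setT setIT probability_setT => H.
split; apply/eqP => G0; move: H; rewrite integral0_eq.
- by move=> /eqP; rewrite onee_eq0.
- by move=> t _; rewrite /scaled_chi2_prob (chi2_prob_Gamma0 _ G0) mul0e.
- by move=> /eqP; rewrite onee_eq0.
- by move=> t _; rewrite /scaled_chi2_prob [X in (_ * X)%E](chi2_prob_Gamma0 _ G0) mule0.
Qed.

Variables (G1 : @Gamma R (m1%:R / 2) != 0) (G2 : @Gamma R (m2%:R / 2) != 0).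

Let s1 := sg1 ^+ 2.
Let s2 := sg2 ^+ 2.

(* [t `^ (-1)] is measurable and agrees with [t^-1] for [t > 0]. *)
Let phi (z : R * (R * R)) : R * R :=
  (s1 * z.1 `^ (-1) * z.2.2, s2 * z.1 `^ (-1) * z.2.1).

Let mphi : measurable_fun setT phi.
Proof.
have mV : measurable_fun setT (fun z : R * (R * R) => z.1 `^ (-1)).
  by apply: (@measurableT_comp _ _ _ _ _ _ (fun x : R => x `^ (-1))).
by apply: measurable_fun_pair; apply: measurable_funM;
  [exact: measurable_funM|exact: measurableT_comp|
   exact: measurable_funM|exact: measurableT_comp].
Qed.

Let S12 w : R * R := (S1 w, S2 w).

Let mS12 : measurable_fun setT S12.
Proof. exact: measurable_fun_pair. Qed.

Let integral_Pi (f : R -> \bar R) : measurable_fun setT f ->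
  (forall t, 0 <= f t)%E -> (\int[Pi]_(t in `]0%R, +oo[) f t = \int[Pi]_t f t)%E.
Proof.
move=> mf f0; rewrite integral_mkcond.
have m0 : measurable (`]0, +oo[%classic : set R) by [].
apply: (integral_conull (mu := Pi) m0).
  by have := probability_setC Pi m0; rewrite Pi_pos subee.
by move=> t t0; rewrite patchE mem_set.
Qed.

(** [V2] comes before [V1], so that [V1] is the inner variable as in [chi2_tail]. *)
Let Q2 : probability (R * R)%type R := (chi2_law G2 \x chi2_law G1)%E.
Let Q : probability (R * (R * R))%type R := (Pi \x Q2)%E.

(** Both sides are finite measures that agree on the pi-system of measurable rectangles. *)
Let law_eq (A : set (R * R)) : measurable A ->
  image_measure P mS12 A =
  image_measure Q mphi A.
Proof.
apply: (measure_unique [set C1 `*` C2 | C1 in measurable & C2 in measurable]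
  (fun=> setT)).
- exact: measurable_prod_measurableType.
- move=> _ _ [C1 mC1 [C2 mC2 <-]] [D1 mD1 [D2 mD2 <-]]; rewrite -setXI.
  exists (C1 `&` D1); first exact: measurableI.
  by exists (C2 `&` D2) => //; exact: measurableI.
- by move=> _; exists setT => //; exists setT => //; rewrite setXTT.
- by rewrite bigcup_const.
- move=> _ [C1 mC1 [C2 mC2 <-]].
  rewrite /= /pushforward.
  rewrite (_ : S12 @^-1` _ = S1 @^-1` C1 `&` S2 @^-1` C2)//.
  rewrite mixture_model_rect//.
  have mphiC : measurable (phi @^-1` (C1 `*` C2)).
    by rewrite -[X in measurable X]setTI; apply: mphi => //; exact: measurableX.
  rewrite /Q /= [RHS]/product_measure1 -integral_Pi; last 2 first.
  - exact: (measurable_fun_xsection Q2).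
  - by move=> t; exact: measure_ge0.
  apply: eq_integral => t; rewrite inE/= in_itv/= andbT => t0.
  have tV : t `^ (-1) = t^-1 by rewrite powR_inv1// ltW.
  have E1 : scaled_chi2_prob m1 (sg1 ^+ 2 / t) C1 =
    chi2_law G1 [set u | C1 (s1 / t * u)] := erefl.
  have E2 : scaled_chi2_prob m2 (sg2 ^+ 2 / t) C2 =
    chi2_law G2 [set v | C2 (s2 / t * v)] := erefl.
  rewrite (_ : xsection _ t = [set v | C2 (s2 / t * v)] `*` [set u | C1 (s1 / t * u)]).
    have mM (C : set R) (s : R) : measurable C -> measurable [set v | C (s / t * v)].
      move=> mC; rewrite -[X in measurable X]setTI.
      exact: (@measurable_funM _ _ _ _ (cst (s / t)) id).
    rewrite product_measure1E; [|exact: mM|exact: mM].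
    rewrite E1 E2; exact: muleC.
  apply/seteqP; split => [[v u]|[v u]] /=; rewrite /xsection/= inE/= /phi/= tV.
    by move=> [].
  by move=> [].
- move=> _; rewrite image_measureE preimage_setT.
  by rewrite (le_lt_trans (probability_le1 _ _))// ltry.
Qed.

Lemma integral_mixture (h : R * R -> \bar R) : measurable_fun setT h ->
  (forall z, 0 <= h z)%E ->
  (\int[P]_w h (S1 w, S2 w) =
   \int[Pi]_(t in `]0%R, +oo[) \int[chi2_law G2]_v \int[chi2_law G1]_u
     h (s1 / t * u, s2 / t * v)%R)%E.
Proof.
move=> mh h0; rewrite -(integral_image_measure _ mS12)//.
rewrite (eq_measure_integral _ (fun A mA _ => law_eq mA)).
rewrite integral_image_measure// /Q fubini_tonelli1//; last exact: measurableT_comp.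
rewrite -integral_Pi; last 2 first.
- apply: measurable_fun_fubini_tonelli_F => //; exact: measurableT_comp.
- by move=> t; exact: integral_ge0.
apply: eq_integral => t; rewrite inE/= in_itv/= andbT => t0; rewrite /fubini_F.
rewrite (fubini_tonelli1 (fun z => h (phi (t, z))))//; last first.
  apply: (measurableT_comp (f := h \o phi)); first exact: measurableT_comp.
  exact: pair1_measurable.
apply: eq_integral => v _; apply: eq_integral => u _.
by rewrite /phi/= powR_inv1// ltW.
Qed.

End mixture_law.

(** * Tail moments under the mixture model *)

Section mixture_tail.
Context {R : realType} (Pi : probability R R) (p q m1 m2 : nat).
Context (th1 : p.-tuple R) (th2 : q.-tuple R) (sg1 sg2 : R).
Context d (T : measurableType d) (P : probability T R).
Context (tau : {RV P >-> R}) (X1 : {RV P >-> p.-tuple R}) (S1 : {RV P >-> R})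
    (X2 : {RV P >-> q.-tuple R}) (S2 : {RV P >-> R}).
Hypothesis Pi_pos : Pi `]0, +oo[%classic = 1%E.
Hypotheses (sg1_pos : 0 < sg1) (sg2_pos : 0 < sg2).
Hypothesis model : mixture_model Pi m1 m2 th1 th2 sg1 sg2 tau X1 S1 X2 S2.

Let chi2_prob_neg m (c : R) : 0 < c -> scaled_chi2_prob m c `]-oo, 0] = 0%E.
Proof.
move=> c0; apply: integral0_eq => v /=; rewrite in_itv/= pmulr_rle0// => v0.
by rewrite chi2_pdf_le0.
Qed.

Lemma mixture_model_pos :
  exists2 D : set T, measurable D /\ P (~` D) = 0%E &
    forall w, D w <-> 0 < S1 w /\ 0 < S2 w.
Proof.
have mN (S : {RV P >-> R}) : measurable (S @^-1` `]-oo, 0]).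
  by rewrite -[X in measurable X]setTI; exact: (measurable_funPT S).
exists (~` (S1 @^-1` `]-oo, 0] `|` S2 @^-1` `]-oo, 0])).
  split; first by apply: measurableC; exact: measurableU.
  rewrite setCK; apply/eqP; rewrite -measure_le0.
  have N1 : P (S1 @^-1` `]-oo, 0]) = 0%E.
    rewrite -[X in P X]setIT -(preimage_setT S2).
    rewrite (mixture_model_rect sg1_pos sg2_pos model)// integral0_eq// => t /=.
    rewrite in_itv/= andbT => t0.
    by rewrite chi2_prob_neg ?mul0e// divr_gt0// exprn_gt0.
  have N2 : P (S2 @^-1` `]-oo, 0]) = 0%E.
    rewrite -[X in P X]setTI -(preimage_setT S1).
    rewrite (mixture_model_rect sg1_pos sg2_pos model)// integral0_eq// => t /=.
    rewrite in_itv/= andbT => t0.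
    by rewrite [X in (_ * X)%E]chi2_prob_neg ?mule0// divr_gt0// exprn_gt0.
  have := measureU2 P (mN S1) (mN S2).
  by rewrite [X in (_ <= X + _)%E]N1 [X in (_ <= _ + X)%E]N2 adde0.
move=> w; rewrite setCU /setC/= !in_itv/=; split.
  by move=> [/negP + /negP]; rewrite -!ltNge.
by rewrite !ltNge => -[/negP ? /negP ?].
Qed.

Variables (G1 : @Gamma R (m1%:R / 2) != 0) (G2 : @Gamma R (m2%:R / 2) != 0).

(** In [x * S2 <= S1] the scale [1 / t] cancels and the variances leave the factor
    [sg2 ^+ 2 / sg1 ^+ 2]; [t] survives only in the power of [S2]. *)
Lemma integral_mixture_ray (j : nat) (x : R) : 0 < x ->
  (\int[P]_w (if (0 < S2 w)%R && (x * S2 w <= S1 w)%R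
              then (S2 w / sg2 ^+ 2) ^+ j else 0)%:E =
   \int[Pi]_(t in `]0%R, +oo[) ((t^-1 ^+ j)%:E *
     chi2_tail j m1 m2 (x * (sg2 ^+ 2 / sg1 ^+ 2))))%E.
Proof.
move=> x0; pose s1 := sg1 ^+ 2; pose s2 := sg2 ^+ 2.
have s10 : 0 < s1 by rewrite exprn_gt0.
have s20 : 0 < s2 by rewrite exprn_gt0.
pose h (z : R * R) : \bar R :=
  (if (0 < z.2) && (x * z.2 <= z.1) then (z.2 / s2) ^+ j else 0)%:E.
have h0 z : (0 <= h z)%E.
  rewrite lee_fin; case: ifP => // /andP[z0 _].
  by rewrite exprn_ge0// divr_ge0// ltW.
have mh : measurable_fun setT h.
  apply: measurableT_comp => //; apply: measurable_fun_ifT => //.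
  - apply: measurable_and; first exact: measurable_fun_ltr.
    by apply: measurable_fun_ler => //; exact: measurable_funM.
  - by apply: measurable_funX; exact: measurable_funM.
rewrite (integral_mixture Pi_pos sg1_pos sg2_pos model G1 G2 mh h0).
apply: eq_integral => t; rewrite inE/= in_itv/= andbT => t0.
have tV0 : 0 < t^-1 by rewrite invr_gt0.
have E v u : h (s1 / t * u, s2 / t * v) =
    ((t^-1 ^+ j)%:E * chi2_ray j (x * (s2 / s1)) (v, u))%E.
  rewrite /h /chi2_ray/= -EFinM; congr EFin.
  rewrite pmulr_rgt0 ?divr_gt0//.
  have -> : (x * (s2 / t * v) <= s1 / t * u) = (v * (x * (s2 / s1)) <= u).
    rewrite -[RHS](ler_pM2l (divr_gt0 s10 t0)); congr (_ <= _).
    by field; rewrite !gt_eqF.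
  case: ifP => _; last by rewrite mulr0.
  rewrite -exprMn; congr (_ ^+ _); field; rewrite !gt_eqF//.
transitivity (\int[chi2_law G2]_v ((t^-1 ^+ j)%:E *
    \int[chi2_law G1]_u chi2_ray j (x * (s2 / s1)) (v, u)))%E.
  apply: eq_integral => v _; rewrite -ge0_integralZl//.
  - by apply: eq_integral => u _; exact: E.
  - apply: (measurableT_comp (measurable_chi2_ray _ _)); exact: pair1_measurable.
  - by move=> u _; exact: chi2_ray_ge0.
  - by rewrite lee_fin exprn_ge0// ltW.
rewrite ge0_integralZl ?chi2_tail_law//.
- exact: (measurable_fun_fubini_tonelli_F (chi2_ray j _) (measurable_chi2_ray _ _)
    (chi2_ray_ge0 _ _)).
- by move=> v _; apply: integral_ge0 => u _; exact: chi2_ray_ge0.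
- by rewrite lee_fin exprn_ge0// ltW.
Qed.

End mixture_tail.

(** * Dominance *)

Lemma bernoulli_ineq (R : realFieldType) (x : R) n : 1 <= x ->
  1 + n%:R * (x - 1) <= x ^+ n.
Proof.
move=> x1; elim: n => [|n IHn]; first by rewrite mul0r addr0 expr0.
have x0 : 0 <= x by exact: le_trans x1.
rewrite exprSr -natr1; apply: le_trans (ler_wpM2r x0 IHn).
have : 0 <= n%:R * (x - 1) ^+ 2 by rewrite mulr_ge0// sqr_ge0.
by lra.
Qed.

Section dominance.
Context {R : realType} (Pi : probability R R) (p q m1 m2 : nat).
Hypothesis hm2 : (0 < m2)%N.
Hypothesis Pi_pos : Pi `]0, +oo[%classic = 1%E.
Hypothesis Pi_inv : Pi.-integrable `]0, +oo[ (fun t : R => (t^-1)%:E).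
Variable psi : R -> R.
Hypothesis psi_pos : forall r : R, 0 < r -> 0 < psi r.
Hypothesis psi_nd : forall r s : R, 0 < r -> r <= s -> psi r <= psi s.
Hypothesis psi_lim : psi r @[r --> 0^'+] --> alpha2E Pi m2.
Hypothesis psi_le : forall r : R, 0 < r -> psi r <= psi_bound Pi m1 m2 r.
Context (th1 : p.-tuple R) (th2 : q.-tuple R) (sg1 sg2 : R).
Hypotheses (sg1_pos : 0 < sg1) (sg2_pos : 0 < sg2) (sg_le : sg1 <= sg2).
Context d (T : measurableType d) (P : probability T R).
Context (tau : {RV P >-> R}) (X1 : {RV P >-> p.-tuple R}) (S1 : {RV P >-> R})
    (X2 : {RV P >-> q.-tuple R}) (S2 : {RV P >-> R}).
Hypothesis model : mixture_model Pi m1 m2 th1 th2 sg1 sg2 tau X1 S1 X2 S2.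

Let G1 : @Gamma R (m1%:R / 2) != 0.
Proof. by have [] := mixture_model_Gamma_neq0 sg1_pos sg2_pos model. Qed.

Let G2 : @Gamma R (m2%:R / 2) != 0.
Proof. by have [] := mixture_model_Gamma_neq0 sg1_pos sg2_pos model. Qed.

Let psi_bound_pos r : 0 < r -> 0 < psi_bound Pi m1 m2 r.
Proof. by move=> r0; exact: lt_le_trans (psi_pos r0) (psi_le r0). Qed.

Let e := mean_inv Pi.

Let e_gt0 : 0 < e.
Proof. by have [] := psi_bound_gt0 Pi_pos Pi_inv G1 (psi_bound_pos ltr01). Qed.

Let a := alpha2E Pi m2.

Let a_gt0 : 0 < a.
Proof. by rewrite invr_gt0 mulr_gt0// ltr0n. Qed.

(** A value below the limit at 0 would be exceeded by [psi] at points close to 0, against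
    monotonicity. *)
Let psi_ge r : 0 < r -> a <= psi r.
Proof.
move=> r0; rewrite leNgt; apply/negP => ra.
near (0 : R)^'+ => x.
have : psi r < psi x by near: x; exact: (cvgr_gt _ psi_lim).
apply/negP; rewrite -leNgt; apply: psi_nd; first by near: x; exact: nbhs_right_gt.
by near: x; exact: nbhs_right_le.
Unshelve. all: end_near. Qed.

(** [psi] is uncontrolled off the positive half-line; extended by its lower bound [a] it is monotone
    on the whole line, hence measurable. *)
Let psi0 (z : R) : R := if 0 < z then psi z else a.

Let measurable_psi0 : measurable_fun setT psi0.
Proof.
apply: nondecreasing_measurable => // x y xy; rewrite /psi0.
case: (ltP 0 x) => x0; last by case: ifP => // /psi_ge.
by rewrite (lt_le_trans x0 xy); exact: psi_nd.
Qed.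

Let s2 := sg2 ^+ 2.
Let k := sg2 ^+ 2 / sg1 ^+ 2.

Let s2_gt0 : 0 < s2.
Proof. by rewrite exprn_gt0. Qed.

(** The order restriction on the scales enters through this inequality. *)
Let k_ge1 : 1 <= k.
Proof. by rewrite /k ler_pdivlMr ?exprn_gt0// mul1r ler_sqr// nnegrE ltW. Qed.

(* Off the conull event [good], [psi], [ln] and the quotient take uncontrolled
   values: there [Z], [Y] and [W] are set to 0, 1 and [a]. *)
Let good w := (0 < S1 w) && (0 < S2 w).

Let Z w : R := if good w then S1 w / S2 w else 0.
Let Y w : R := if good w then S2 w / s2 else 1.
Let W w : R := psi0 (Z w).

Let Y_gt0 w : 0 < Y w.
Proof. by rewrite /Y /good; case: ifP => // /andP[_ ?]; rewrite divr_gt0. Qed.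

Let W_ge w : a <= W w.
Proof. by rewrite /W /psi0; case: ifP => // /psi_ge. Qed.

Let measurable_good : measurable_fun setT good.
Proof. by apply: measurable_and; exact: measurable_fun_ltr. Qed.

Let measurable_Y : measurable_fun setT Y.
Proof. by apply: measurable_fun_ifT => //; exact: measurable_funM. Qed.

Let measurable_Z : measurable_fun setT Z.
Proof.
have -> : Z = fun w => if good w then S1 w * (S2 w) `^ (-1) else 0.
  apply/funext => w; rewrite /Z; case: ifP => // /andP[_ w0].
  by rewrite powR_inv1// ltW.
apply: measurable_fun_ifT => //; apply: measurable_funM => //.
exact: (measurableT_comp (measurable_powR (-1))).
Qed.

Let measurable_W : measurable_fun setT W.
Proof. exact: measurableT_comp. Qed.

Let rayZ x w : 0 < x -> (x <= Z w) = (0 < S2 w) && (x * S2 w <= S1 w).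
Proof.
move=> x0; rewrite /Z /good; have [S20|_] := ltP 0 (S2 w); last first.
  by rewrite andbF/= leNgt x0.
rewrite andbT/=; case: ifPn => [_|S10]; first by rewrite ler_pdivlMr.
rewrite leNgt x0/=; apply/esym/negP => xS; move: S10; rewrite -leNgt leNgt.
by move=> /negP; apply; apply: lt_le_trans xS; rewrite mulr_gt0.
Qed.

Let preimage_ray x : measurable (Z @^-1` `[x, +oo[).
Proof. by rewrite -[X in measurable X]setTI; exact: measurable_Z. Qed.

Let prob_ray x : 0 < x -> P (Z @^-1` `[x, +oo[) = chi2_tail 0 m1 m2 (x * k).
Proof.
move=> x0; rewrite -(setIT (Z @^-1` _)) -integral_indic//.
transitivity (\int[P]_w (if (0 < S2 w)%R && (x * S2 w <= S1 w)%R
              then (S2 w / sg2 ^+ 2) ^+ 0 else 0)%:E)%E.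
  apply: eq_integral => w _; rewrite indicE -rayZ// expr0.
  rewrite (_ : (w \in _) = (x <= Z w)); first by case: ifP.
  by apply/idP/idP; rewrite inE/= in_itv/= andbT.
rewrite (integral_mixture_ray Pi_pos sg1_pos sg2_pos model G1 G2 0 x0).
under eq_integral do rewrite expr0 mul1e.
by rewrite integral_cst//= [X in (_ * X)%E]Pi_pos mule1.
Qed.

Let mean_ray x : 0 < x -> (\int[P]_(w in Z @^-1` `[x, +oo[) (Y w)%:E =
  e%:E * chi2_tail 1 m1 m2 (x * k))%E.
Proof.
move=> x0; rewrite integral_mkcond.
transitivity (\int[P]_w (if (0 < S2 w)%R && (x * S2 w <= S1 w)%R
              then (S2 w / sg2 ^+ 2) ^+ 1 else 0)%:E)%E.
  apply: eq_integral => w _; rewrite patchE -rayZ// expr1.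
  rewrite (_ : (w \in _) = (x <= Z w)).
    case: ifP => // xZ; rewrite /Y; move: xZ; rewrite rayZ// /good => /andP[S20 xS].
    by rewrite S20 (lt_le_trans _ xS)// mulr_gt0.
  by apply/idP/idP; rewrite inE/= in_itv/= andbT.
rewrite (integral_mixture_ray Pi_pos sg1_pos sg2_pos model G1 G2 1 x0).
under eq_integral do rewrite expr1 muleC.
rewrite ge0_integralZl//.
- by rewrite integral_inv// muleC.
- exact: (measurable_int Pi).
- by move=> t /=; rewrite in_itv/= andbT => t0; rewrite lee_fin invr_ge0 ltW.
- exact: chi2_tail_ge0.
Qed.

Let level (y : R) : set R := [set x | 0 < x /\ y < psi x].

(** Where [Z] is not positive, [W] equals [a] and does not exceed [y]. *)
Let levelW y : a <= y -> [set w | y < W w] = Z @^-1` level y.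
Proof.
move=> ay; apply/seteqP; split => w; rewrite /level /W /psi0/=.
  by case: ifP => // _ /(le_lt_trans ay); rewrite ltxx.
by move=> [-> ].
Qed.

(** [level y] is upward closed, so rays suffice; on a ray from [x] the claim is [le_psi_bound] at
    [x * k]. *)
Let level_le b y : 0 <= b ->
  (forall x, 0 < x -> y < psi x -> b <= psi_bound Pi m1 m2 (x * k)) ->
  (b%:E * \int[P]_(w in Z @^-1` level y) (Y w)%:E <= P (Z @^-1` level y))%E.
Proof.
move=> b0 bB; apply: (@upward_closed_le _ _ _ P _ _ measurable_Z measurable_Y _ _ _ 0) => //.
- by move=> w; exact: ltW.
- by move=> x [/ltW].
- move=> x z [x0 yx] xz; split; first exact: lt_le_trans xz.
  by apply: lt_le_trans yx _; exact: psi_nd.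
move=> x [x0 yx]; rewrite [leRHS](prob_ray x0) mean_ray//.
have xk0 : 0 < x * k by rewrite mulr_gt0// (lt_le_trans ltr01).
by apply: le_psi_bound => //; [exact: psi_bound_pos|exact: bB].
Qed.

Let level_psi y : a < y ->
  (\int[P]_(w in Z @^-1` level y) (Y w)%:E <= (y^-1)%:E * P (Z @^-1` level y))%E.
Proof.
move=> ay; have y0 : 0 < y by exact: lt_trans ay.
rewrite -(@lee_pmul2l _ y%:E) ?lte_fin// muleA -EFinM mulfV ?gt_eqF// mul1e.
apply: level_le => [|x x0 yx]; first exact: ltW.
have xk : x <= x * k by rewrite ler_peMr// ltW.
apply: (le_trans (ltW yx)); apply: (le_trans (psi_nd x0 xk)).
by apply: psi_le; exact: lt_le_trans xk.
Qed.

Let risk_psiE : entropy_risk P (delta_psi psi S1 S2) s2 =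
  (\int[P]_w (W w * Y w - ln (W w * Y w) - 1)%:E)%E.
Proof.
have [D [mD D0] DE] := mixture_model_pos sg1_pos sg2_pos model.
rewrite /entropy_risk unlock; apply: (integral_conull mD D0) => w /DE[S10 S20].
congr EFin; rewrite /entropy_loss /delta_psi /W /Y /Z /good S10 S20/=.
by rewrite /psi0 divr_gt0// mulrA.
Qed.

Let risk_02E : entropy_risk P (delta02E Pi m2 S2) s2 =
  (\int[P]_w (a * Y w - ln (a * Y w) - 1)%:E)%E.
Proof.
have [D [mD D0] DE] := mixture_model_pos sg1_pos sg2_pos model.
rewrite /entropy_risk unlock; apply: (integral_conull mD D0) => w /DE[S10 S20].
congr EFin; rewrite /entropy_loss /delta02E /Y /good S10 S20/=.
by rewrite mulrA.
Qed.

Lemma dominance_weak :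
  (entropy_risk P (delta_psi psi S1 S2) (sg2 ^+ 2)
     <= entropy_risk P (delta02E Pi m2 S2) (sg2 ^+ 2))%E.
Proof.
rewrite risk_psiE risk_02E.
(* With [eps = 0] and the empty interval []a, a[] no excess is required. *)
have := @risk_improvement _ _ _ P a W Y a_gt0 W_ge Y_gt0 measurable_W measurable_Y
  0 a a (lexx _) (lexx _) (lexx _).
rewrite mul0r adde0; apply => y ay.
rewrite (levelW (ltW ay)); case: ifP => _; rewrite adde0; exact: level_psi.
Qed.

(** A level [y] above [psi r] is exceeded only at points [x >= r], where [B] may replace [y] in the
    level inequality. For [y < c < B] this leaves an excess of at least
    [P(Z >= s) * (1 / c - 1 / B)]. *)
Lemma dominance_strict (r s B : R) :
  (entropy_risk P (delta02E Pi m2 S2) (sg2 ^+ 2) < +oo)%E ->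
  0 < r -> 0 < s -> psi r < psi s -> psi r < B ->
  (forall x, r <= x -> B <= psi_bound Pi m1 m2 (x * k)) ->
  (entropy_risk P (delta_psi psi S1 S2) (sg2 ^+ 2)
     < entropy_risk P (delta02E Pi m2 S2) (sg2 ^+ 2))%E.
Proof.
rewrite risk_psiE risk_02E => fin r0 s0 rs rB BP.
have [c [rc cs cB]] : exists c, [/\ psi r < c, c < psi s & c < B].
  exists ((psi r + Num.min (psi s) B) / 2).
  by rewrite minElt; case: ifP => H; split; lra.
have [q0 q0_gt0 q0E] : exists2 x, 0 < x & P (Z @^-1` `[s, +oo[) = x%:E.
  rewrite prob_ray//.
  have sk0 : 0 < s * k by rewrite mulr_gt0// (lt_le_trans ltr01).
  by have [] := psi_bound_gt0 Pi_pos Pi_inv G1 (psi_bound_pos sk0).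
have c0 : 0 < c by rewrite (lt_trans (psi_pos r0)).
have B0 : 0 < B by exact: lt_trans cB.
pose eps := q0 * (c^-1 - B^-1).
have eps_gt0 : 0 < eps by rewrite mulr_gt0// subr_gt0 ltf_pV2 ?posrE.
have := @risk_improvement _ _ _ P a W Y a_gt0 W_ge Y_gt0 measurable_W measurable_Y
  eps (psi r) c (ltW eps_gt0) (psi_ge r0) (ltW rc).
have gap : forall y, a < y ->
  (\int[P]_(w in [set w | (y < W w)%R]) (Y w)%:E
     + (if (psi r < y < c)%R then eps else 0)%:E
   <= (y^-1)%:E * P [set w | (y < W w)%R])%E.
  move=> y ay; rewrite (levelW (ltW ay)).
  case: ifP => [/andP[ry yc]|_]; last by rewrite adde0; exact: level_psi.
  have y0 : 0 < y by exact: lt_trans ay.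
  have mL : measurable (Z @^-1` level y).
    rewrite -(levelW (ltW ay)).
    have := @measurable_fun_ltr _ _ _ setT (cst y) W (measurable_cst _) measurable_W.
    move=> /(_ measurableT [set true] I); rewrite setTI.
    by congr measurable; apply/seteqP; split=> w.
  have : (q0%:E <= P (Z @^-1` level y))%E.
    rewrite -q0E; apply: le_measure; rewrite ?inE//.
    move=> w /=; rewrite in_itv/= andbT => sZ; split; first exact: lt_le_trans sZ.
    by apply: (lt_le_trans (lt_trans yc cs)); exact: psi_nd.
  have : (B%:E * \int[P]_(w in Z @^-1` level y) (Y w)%:E <= P (Z @^-1` level y))%E.
    apply: level_le => [|x x0 yx]; first exact: ltW.
    apply: BP; rewrite leNgt; apply/negP => xr.
    have := lt_trans ry yx; rewrite ltNge => /negP; apply.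
    by apply: psi_nd => //; exact: ltW.
  have : (P (Z @^-1` level y) \is a fin_num) by exact: fin_num_measure.
  have : (0 <= \int[P]_(w in Z @^-1` level y) (Y w)%:E)%E.
    by apply: integral_ge0 => w _; rewrite lee_fin ltW.
  case: (\int[P]_(w in Z @^-1` level y) (Y w)%:E)%E => [I| |]//; last first.
    by move=> _ /fineK <-; rewrite gt0_muley ?lte_fin// leye_eq.
  case: (P (Z @^-1` level y)) => [Q| |]//.
  rewrite lee_fin => I0 _; rewrite -!EFinM -EFinD !lee_fin => BI qQ.
  have IQ : I <= Q / B by rewrite ler_pdivlMr// mulrC.
  have epsQ : eps <= Q * (c^-1 - B^-1).
    by rewrite ler_wpM2r// subr_ge0 lef_pV2 ?posrE// ltW.
  have Qy : Q / c <= y^-1 * Q.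
    rewrite mulrC ler_wpM2r ?lef_pV2 ?posrE//; last exact: ltW.
    by rewrite (le_trans (ltW q0_gt0)).
  by apply: le_trans Qy; move: epsQ IQ; rewrite mulrBr; lra.
(* A positive gain gives a strict inequality only because the smaller risk is finite. *)
move=> /(_ gap) H; apply: lt_le_trans H.
have : (\int[P]_w (W w * Y w - ln (W w * Y w) - 1)%:E < +oo)%E.
  by apply: le_lt_trans fin; rewrite -risk_psiE -risk_02E; exact: dominance_weak.
have : (0 <= \int[P]_w (W w * Y w - ln (W w * Y w) - 1)%:E)%E.
  apply: integral_ge0 => w _; rewrite lee_fin.
  have WY : 0 < W w * Y w by rewrite mulr_gt0// (lt_le_trans a_gt0).
  have /le_ln1Dx : -1 < W w * Y w - 1 by lra.
  by rewrite addrC subrK; lra.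
case: (\int[P]_w _)%E => [I| |]// _ _.
by rewrite -EFinD lte_fin ltrDl mulr_gt0// subr_gt0.
Qed.

(** Without such a jump, [psi] would stay at most [psi r] along [r * k ^+ n], which eventually
    passes [s]. *)
Let geometric_jump r s : 1 < k -> 0 < r -> 0 < s -> psi r < psi s ->
  exists2 r1, 0 < r1 & psi r1 < psi (r1 * k).
Proof.
move=> k1 r0 s0 rs; apply: contrapT => nex.
have step x : 0 < x -> psi (x * k) <= psi x.
  by move=> x0; rewrite leNgt; apply/negP => H; apply: nex; exists x.
have k0 : 0 < k by exact: lt_trans k1.
have le_r n : psi (r * k ^+ n) <= psi r.
  elim: n => [|n IHn]; first by rewrite expr0 mulr1.
  by rewrite exprSr mulrA (le_trans (step _ _))// mulr_gt0// exprn_gt0.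
have [n sn] : exists n, s <= r * k ^+ n.
  (* With this [n], Bernoulli's inequality gives [k ^+ n >= n * (k - 1) >= s / r]. *)
  exists (Num.truncn (s / r / (k - 1))).+1.
  rewrite mulrC -ler_pdivrMr//; apply: le_trans (bernoulli_ineq _ k_ge1).
  rewrite (@le_trans _ _ ((Num.truncn (s / r / (k - 1))).+1%:R * (k - 1)))//.
    by rewrite -ler_pdivrMr ?subr_gt0//; exact/ltW/truncnS_gt.
  by rewrite lerDr.
by have := le_trans (psi_nd s0 sn) (le_r n); rewrite leNgt rs.
Qed.

Lemma dominance_strict_cases r s :
  (entropy_risk P (delta02E Pi m2 S2) (sg2 ^+ 2) < +oo)%E ->
  0 < r -> r < s -> psi r < psi s ->
  sg1 < sg2 \/ psi r < psi_bound Pi m1 m2 r ->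
  (entropy_risk P (delta_psi psi S1 S2) (sg2 ^+ 2)
     < entropy_risk P (delta02E Pi m2 S2) (sg2 ^+ 2))%E.
Proof.
move=> fin r0 rs psi_rs; have s0 := lt_trans r0 rs.
have k0 : 0 < k by exact: lt_le_trans k_ge1.
case=> [sg12|rB]; last first.
  (* Here [B] is [psi_bound] at [r]. *)
  apply: (dominance_strict fin r0 s0 psi_rs rB) => x rx.
  have rxk : r <= x * k.
    by rewrite (le_trans rx)// ler_peMr// ltW// (lt_le_trans r0).
  have xk0 := lt_le_trans r0 rxk.
  exact: (psi_bound_nondecreasing Pi_pos Pi_inv G1 r0 rxk (psi_bound_pos r0)
    (psi_bound_pos xk0)).
have k1 : 1 < k by rewrite /k ltr_pdivlMr ?exprn_gt0// mul1r ltr_sqr// nnegrE ltW.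
have [r1 r10 jump] := geometric_jump k1 r0 s0 psi_rs.
have rk0 : 0 < r1 * k by rewrite mulr_gt0.
(* Here [s] is [r1 * k] and [B] is [psi (r1 * k)]. *)
apply: (dominance_strict fin r10 rk0 jump jump) => x rx.
have xk : r1 * k <= x * k by rewrite ler_pM2r.
by apply: (le_trans (psi_nd rk0 xk)); apply: psi_le; exact: lt_le_trans xk.
Qed.

End dominance.

(** A constant [psi1] equals [alpha2E], and the two estimators then coincide almost surely; hence
    the strict part asks for a strict increase. If [sg1 = sg2] and [psi1] attains [psi_bound], the
    level inequalities can become equalities, hence the alternative. *)
Theorem theorem3p8 (R : realType) (p q m1 m2 : nat)
    (hp : (0 < p)%N) (hq : (0 < q)%N) (hm1 : (0 < m1)%N) (hm2 : (0 < m2)%N)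
    (Pi : probability R R)
    (Pi_pos : Pi `]0, +oo[%classic = 1%E)
    (Pi_inv : Pi.-integrable `]0, +oo[ (fun t : R => (t^-1)%:E))
    (psi1 : R -> R)
    (psi1_pos : forall r : R, 0 < r -> 0 < psi1 r)
    (psi1_nondecreasing : forall r s : R, 0 < r -> r <= s -> psi1 r <= psi1 s)
    (psi1_lim : psi1 r @[r --> 0^'+] --> alpha2E Pi m2)
    (psi1_le : forall r : R, 0 < r -> psi1 r <= psi_bound Pi m1 m2 r)
    (th1 : p.-tuple R) (th2 : q.-tuple R) (sg1 sg2 : R)
    (sg1_pos : 0 < sg1) (sg2_pos : 0 < sg2) (sg_le : sg1 <= sg2)
    (d : measure_display) (T : measurableType d) (P : probability T R)
    (tau : {RV P >-> R}) (X1 : {RV P >-> p.-tuple R}) (S1 : {RV P >-> R})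
    (X2 : {RV P >-> q.-tuple R}) (S2 : {RV P >-> R})
    (model : mixture_model Pi m1 m2 th1 th2 sg1 sg2 tau X1 S1 X2 S2) :
  (entropy_risk P (delta_psi psi1 S1 S2) (sg2 ^+ 2)
     <= entropy_risk P (delta02E Pi m2 S2) (sg2 ^+ 2))%E /\
  ((entropy_risk P (delta02E Pi m2 S2) (sg2 ^+ 2) < +oo)%E ->
   (exists r s : R, [/\ 0 < r, r < s, psi1 r < psi1 s
      & sg1 < sg2 \/ psi1 r < psi_bound Pi m1 m2 r]) ->
   (entropy_risk P (delta_psi psi1 S1 S2) (sg2 ^+ 2)
      < entropy_risk P (delta02E Pi m2 S2) (sg2 ^+ 2))%E).
Proof.
split.
  exact: (dominance_weak hm2 Pi_pos Pi_inv psi1_pos psi1_nondecreasing psi1_lim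
    psi1_le sg1_pos sg2_pos sg_le model).
move=> fin [r [s [r0 rs psi_rs cases]]].
exact: (dominance_strict_cases hm2 Pi_pos Pi_inv psi1_pos psi1_nondecreasing
  psi1_lim psi1_le sg1_pos sg2_pos sg_le model fin r0 rs psi_rs cases).
Qed.
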